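(* Under the setting and assumptions on $\mathcal{M}$, $T$, $w$, $\Phi$, $A$ and $S$ listed in the context, the following hold. (1) The kernel $$K(\lambda,\eta)=\langle\Phi(\lambda),\Phi(\eta)\rangle_{L^2(0,\infty)}=\int_0^\infty T(t,\lambda)T(t,\eta)w(t)\,dt,\qquad \lambda,\eta>0,$$ is strictly positive definite and determines a reproducing kernel Hilbert space $H_w$ of functions on $(0,\infty)$. (2) For all $f,g\in H_w$, $$\langle f,g\rangle_{H_w}=\langle S^{-1}f,S^{-1}g\rangle_{L^2(w^{-1})}.$$ (3) The natural pairing $$\langle\mu,f\rangle=\int_0^\infty f(\lambda)\,d\mu(\lambda)$$ (for $\mu\in\mathcal{M}_w^0$, $f\in H_w$) identifies $H_w'$, the Hilbert-space completion of $\mathcal{M}_w^0$, isometrically with the continuous dual of $H_w$.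
   Context: All spaces are over the real numbers. $\mathcal{M}$ is a linear space of signed Borel measures on $(0,\infty)$ containing the finite linear combinations of Dirac masses. $T$ is an injective integral transform on $\mathcal{M}$, $(T\mu)(t)=\int_0^\infty T(t,s)\,d\mu(s)$, $t>0$, with measurable kernel $(t,\lambda)\mapsto T(t,\lambda)$, such that $T\mu$ is defined and continuous for every $\mu\in\mathcal{M}$. The weight $w$ on $(0,\infty)$ is measurable and positive almost everywhere. Define $\Phi(\lambda)(t)=\sqrt{w(t)}\,T(t,\lambda)$ and assume $\Phi(\lambda)\in L^2(0,\infty)$ for every $\lambda>0$. $\mathcal{M}_w^0\subset\mathcal{M}$ is the space of measures $\mu\in\mathcal{M}$ for which $\Phi:(0,\infty)\to L^2(0,\infty)$ is Bochner integrable with respect to $\mu$, and for $\mu\in\mathcal{M}_w^0$ one sets $A\mu=\int_0^\infty\Phi(\lambda)\,d\mu(\lambda)=\sqrt{w}\,T\mu\in L^2(0,\infty)$. The space $\mathcal{M}_w^0$ is equipped with the inner product $$\langle\mu,\nu\rangle_{H_w'}=\int_0^\infty (T\mu)(t)(T\nu)(t)w(t)\,dt=\langle A\mu,A\nu\rangle_{L^2},$$ and $H_w'$ denotes its Hilbert-space completion. $L^2(w^{-1})$ is the space of measurable $h$ with $\int_0^\infty h(t)^2\,dt/w(t)<\infty$, with inner product $\langle h,k\rangle_{L^2(w^{-1})}=\int_0^\infty h(t)k(t)\,dt/w(t)$. The synthesis transform is $(Sh)(\lambda)=\int_0^\infty T(t,\lambda)h(t)\,dt$; it is assumed to be well defined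 and injective on $L^2(w^{-1})$. ''Strictly positive definite'' means $\sum_{i,j}c_ic_jK(\lambda_i,\lambda_j)>0$ for every finite set of distinct points $\lambda_i>0$ and real coefficients $c_i$ not all zero. *)

(* Defs.v *)
From HB Require Import structures.
From mathcomp Require Import all_boot all_order all_algebra.
From mathcomp Require Import all_classical all_reals all_analysis.

Set Implicit Arguments.
Unset Strict Implicit.
Unset Printing Implicit Defensive.

Import Order.TTheory GRing.Theory Num.Theory.
Import numFieldNormedType.Exports.

Local Open Scope classical_set_scope.
Local Open Scope ring_scope.

(* A Hilbert space: a complete normed space whose norm comes from an inner
   product. *)
HB.mixin Record NormedModule_hasInner (R : realType) V
    & NormedModule R V := {
  inner : V -> V -> R ;
  innerC : forall u v, inner u v = inner v u ;
  innerP : forall a u v x, inner (a *: u + v) x = a * inner u x + inner v x ;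
  inner_norm : forall u, inner u u = `|u| ^+ 2
}.

#[short(type="hilbertType")]
HB.structure Definition Hilbert (R : realType) :=
  { V of CompleteNormedModule R V & NormedModule_hasInner R V }.

Section ChargeIntegral.
Context d (T : measurableType d) (R : realType).
Implicit Types (nu : {charge set T -> \bar R}) (D : set T) (f : T -> R).

(* The Jordan decomposition and the variation do not depend, on measurable
   sets, on the Hahn decomposition chosen here. *)
Definition hahn_pos nu : set T := sval (cid (Hahn_decomposition nu)).
Definition hahn_neg nu : set T := sval (cid (svalP (cid (Hahn_decomposition nu)))).
Definition hahnP nu : hahn_decomposition nu (hahn_pos nu) (hahn_neg nu) :=
  svalP (cid (svalP (cid (Hahn_decomposition nu)))).

Definition variation nu : {measure set T -> \bar R} :=
  charge_variation (hahnP nu).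

Definition charge_integrable nu D f :=
  (variation nu).-integrable D (EFin \o f).

Definition charge_integral nu D f : R :=
  \int[jordan_pos (hahnP nu)]_(x in D) f x
    - \int[jordan_neg (hahnP nu)]_(x in D) f x.

End ChargeIntegral.

Notation signed_measure R :=
  (charge (measurableTypeR R) R).

Section Setting.
Context (R : realType).

Local Notation rT := (measurableTypeR R).
Local Notation leb := (@lebesgue_measure R).

(* A function on (0, oo) is represented by a function on R whose values outside
   (0, oo) are irrelevant, and a signed measure on (0, oo) by a (finite) signed
   measure on R concentrated on (0, oo). *)
Definition posR : set rT := [set x | 0 < x].

Definition concentrated (mu : signed_measure R) :=
  forall A, measurable A -> mu (A `&` posR) = mu A.

Definition dirac_charge (a : R) : signed_measure R :=
  charge_of_finite_measure (@dirac _ rT a R).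

Definition dirac_linear_space (M : set (signed_measure R)) :=
  [/\ forall mu, M mu -> concentrated mu,
      forall mu nu, M mu -> M nu -> M (cadd mu nu),
      forall a mu, M mu -> M (cscale a mu) &
      forall a, posR a -> M (dirac_charge a)].

(* The space L^2(rho(t) dt) on (0, oo), as a space of functions; equality of
   its elements is almost everywhere equality. *)
Definition L2 (rho h : rT -> R) :=
  measurable_fun posR h /\
  (\int[leb]_(t in posR) (h t ^+ 2 * rho t)%:E < +oo)%E.

Definition L2dot (rho h k : rT -> R) : R :=
  \int[leb]_(t in posR) (h t * k t * rho t).

Definition L2norm (rho h : rT -> R) : R := Num.sqrt (L2dot rho h h).

Definition ae_eq_pos (h k : rT -> R) :=
  {ae leb, forall t, posR t -> h t = k t}.

Definition L2simple (s : rT -> rT -> R) :=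
  [/\ finite_set (range s),
      forall g, measurable (s @^-1` [set g]) &
      forall x, L2 (cst 1) (s x)].

(* Strong measurability and Bochner integrability of an L^2(0, oo)-valued
   function on (0, oo), with L^2 norms taken on representatives. *)
Definition bochner_integrable (mu : {measure set rT -> \bar R})
    (F : rT -> rT -> R) :=
  exists s : nat -> rT -> rT -> R,
    [/\ forall n, L2simple (s n),
        {ae mu, forall x, posR x ->
           L2norm (cst 1) (fun t => F x t - s n x t) @[n --> \oo] --> 0} &
        (\int[mu]_(x in posR) (L2norm (cst 1) (fun t => F x t - s n x t))%:E)%E
          @[n --> \oo] --> 0%E].

Section Transform.
Context (M : set (signed_measure R)) (T : rT -> rT -> R) (w : rT -> R).

Definition transform (mu : signed_measure R) (t : rT) : R :=
  charge_integral mu posR (T t).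

Definition Phi (x t : rT) : R := Num.sqrt (w t) * T t x.

Definition kernel_w (x y : rT) : R := L2dot (cst 1) (Phi x) (Phi y).

Definition Mw0 : set (signed_measure R) :=
  [set mu | M mu /\ bochner_integrable (variation mu) Phi].

Definition dot_w (mu nu : signed_measure R) : R :=
  L2dot w (transform mu) (transform nu).

Definition winv (t : rT) : R := (w t)^-1.

Definition synthesis (h : rT -> R) (x : rT) : R :=
  \int[leb]_(t in posR) (T t x * h t).

(* [synthesis_at f h] says that h is in L^2(1/w) and S h = f on (0, oo). *)
Definition synthesis_at (f h : rT -> R) :=
  L2 winv h /\ forall x, posR x -> synthesis h x = f x.

(* Specified, up to almost everywhere equality, when f is in the range of S. *)
Definition synthesis_inv (f : rT -> R) : rT -> R :=
  xget (cst 0) (synthesis_at f).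

(* [iota] exhibits H as a Hilbert space completion of Mw0 with the inner product
   dot_w; its values outside Mw0 are irrelevant. *)
Definition is_completion (H : hilbertType R)
    (iota : signed_measure R -> H) :=
  [/\ forall mu nu, Mw0 mu -> Mw0 nu -> iota (cadd mu nu) = iota mu + iota nu,
      forall a mu, Mw0 mu -> iota (cscale a mu) = a *: iota mu,
      forall mu nu, Mw0 mu -> Mw0 nu -> inner (iota mu) (iota nu) = dot_w mu nu &
      dense (iota @` Mw0)].

End Transform.

End Setting.

Section Kernels.
Context (R : realType) (X : Type) (D : set X) (K : X -> X -> R).

Definition strictly_positive_definite :=
  forall n (x : 'I_n -> X) (c : 'I_n -> R),
    injective x -> (forall i, D (x i)) -> (exists i, c i != 0) ->
    0 < \sum_(i < n) \sum_(j < n) c i * c j * K (x i) (x j).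

(* [ev] realises the elements of H as functions on D. *)
Definition is_rkhs (H : hilbertType R) (ev : H -> X -> R) :=
  [/\ forall a f g x, D x -> ev (a *: f + g) x = a * ev f x + ev g x,
      forall f g, (forall x, D x -> ev f x = ev g x) -> f = g &
      forall x, D x -> exists2 k : H,
        (forall y, D y -> ev k y = K y x) & forall f, ev f x = inner f k].

(* K is the kernel of exactly one Hilbert space of functions on D. *)
Definition determines_rkhs :=
  exists (H : hilbertType R) (ev : H -> X -> R), is_rkhs ev /\
    forall (H' : hilbertType R) (ev' : H' -> X -> R), is_rkhs ev' ->
      exists U : H -> H',
        [/\ bijective U,
            forall f g, inner (U f) (U g) = inner f g &
            forall f x, D x -> ev' (U f) x = ev f x].

End Kernels.

Definition is_dual (R : realType) (H : hilbertType R) (phi : H -> R) :=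
  scalar phi /\ continuous phi.

Definition dual_norm (R : realType) (H : hilbertType R) (phi : H -> R) : R :=
  sup [set `|phi f| | f in [set f : H | `|f| <= 1]].

Definition isometry_onto_dual (R : realType) (H' H : hilbertType R)
    (J : H' -> H -> R) :=
  [/\ forall u, is_dual (J u),
      forall a u v f, J (a *: u + v) f = a * J u f + J v f,
      forall phi, is_dual phi -> exists u, J u = phi &
      forall u, dual_norm (J u) = `|u|].

(* Main.v *)
From HB Require Import structures.
Require Import Defs.
From mathcomp Require Import all_boot all_order all_algebra.
From mathcomp Require Import all_classical all_reals all_analysis.
From mathcomp Require Import measurable_realfun ring lra.
Import Order.TTheory GRing.Theory Num.Theory.
Import numFieldNormedType.Exports.
Import Defs.
Set Implicit Arguments.
Unset Strict Implicit.
Unset Printing Implicit Defensive.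
Local Open Scope classical_set_scope.
Local Open Scope ring_scope.

(** Everything takes place in the Hilbert space [L^2(0, oo)], of which [L^2(1/w)],
    [H_w] and [H_w'] are isometric copies.

    Multiplication by [sqrt w] maps [L^2] isometrically onto [L^2(1/w)], and
    [S (sqrt w g) x] is the inner product of [g] with [Phi x].  Injectivity of [S]
    therefore says exactly that the vectors [Phi x] are total in [L^2].  Hence
    [g |-> (x |-> <g, Phi x>)] realises [L^2] as a space of functions with
    reproducing kernel [K] ([is_rkhs_L2ev]); any other such space is
    isometric to it, because kernel functions are total and have the Gram matrix
    [K] ([rkhs_unitary]).  Part (2) is this identification read
    through [S], since [S^-1 f = sqrt w g] when [f] corresponds to [g].

    Strict positivity of [K] is linear independence of the [Phi x].  A linear
    relation between them says that the transform of a combination of Dirac masses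
    vanishes almost everywhere; being continuous it vanishes everywhere, so the
    combination is zero by injectivity of [T].

    For [mu] in [M_w^0] the function [A mu = sqrt w T mu] is square integrable and
    satisfies [<A mu, g> = int <Phi x, g> dmu(x)].  Both facts come from Fubini's
    theorem, which applies because Bochner integrability bounds the integral of
    [|Phi x|] against the variation of [mu]; square integrability then follows by
    duality ([sqint_of_bounded_pairing]).  The range of [A] contains all
    [Phi x], the images of the Dirac masses, so it is dense and [L^2] is a
    completion of [M_w^0] ([is_completion_L2embed]).  Completions being unique,
    every one of them is isometric to [L^2], hence to [H_w], and composing with the
    Riesz representation theorem gives the isometry onto the dual in part (3).

    Three pieces of general theory support this: projections, the Riesz theorem and
    extension of isometries in Hilbert spaces; the Riesz-Fischer theorem and the
    quotient of square integrable functions by almost everywhere equality; and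
    integration against a signed measure. *)

(** * Inner product spaces *)

Section InnerProduct.
Context (R : realType) (H : hilbertType R).
Implicit Types (u v x : H) (a : R).

Lemma inner0l x : inner 0 x = 0.
Proof.
have := innerP 1 0 0 x; rewrite scaler0 addr0; lra.
Qed.

Lemma innerDl u v x : inner (u + v) x = inner u x + inner v x.
Proof. by have := innerP 1 u v x; rewrite scale1r mul1r. Qed.

Lemma innerZl a u x : inner (a *: u) x = a * inner u x.
Proof. by have := innerP a u 0 x; rewrite inner0l !addr0. Qed.

Lemma innerNl u x : inner (- u) x = - inner u x.
Proof. by rewrite -scaleN1r innerZl mulN1r. Qed.

Lemma innerBl u v x : inner (u - v) x = inner u x - inner v x.
Proof. by rewrite innerDl innerNl. Qed.

Lemma inner0r x : inner x 0 = 0.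
Proof. by rewrite innerC inner0l. Qed.

Lemma innerDr u v x : inner x (u + v) = inner x u + inner x v.
Proof. by rewrite innerC innerDl !(innerC x). Qed.

Lemma innerZr a u x : inner x (a *: u) = a * inner x u.
Proof. by rewrite innerC innerZl (innerC x). Qed.

Lemma innerNr u x : inner x (- u) = - inner x u.
Proof. by rewrite innerC innerNl (innerC x). Qed.

Lemma innerBr u v x : inner x (u - v) = inner x u - inner x v.
Proof. by rewrite innerDr innerNr. Qed.

Lemma normD2 u v : `|u + v| ^+ 2 = `|u| ^+ 2 + 2 * inner u v + `|v| ^+ 2.
Proof.
rewrite -!inner_norm innerDl !innerDr (innerC v u); lra.
Qed.

Lemma normB2 u v : `|u - v| ^+ 2 = `|u| ^+ 2 - 2 * inner u v + `|v| ^+ 2.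
Proof. by rewrite normD2 innerNr normrN; lra. Qed.

Lemma innerE u v : inner u v = (`|u + v| ^+ 2 - `|u| ^+ 2 - `|v| ^+ 2) / 2.
Proof. by rewrite normD2; lra. Qed.

(** Expand the square of the norm of [|v|^2 u - <u, v> v]. *)
Lemma cauchy_schwarz u v : `|inner u v| <= `|u| * `|v|.
Proof.
have [->|v0] := eqVneq v 0; first by rewrite inner0r !normr0 mulr0.
have nv0 : 0 < `|v| by rewrite normr_gt0.
have h : (inner u v) ^+ 2 <= (`|u| * `|v|) ^+ 2.
  have := sqr_ge0 `|(`|v| ^+ 2) *: u - inner u v *: v|.
  rewrite normB2 !normrZ innerZl innerZr !exprMn.
  rewrite !real_normK ?num_real//.
  have -> : (`|v| ^+ 2) ^+ 2 * `|u| ^+ 2 -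
     2 * (`|v| ^+ 2 * (inner u v * inner u v)) + inner u v ^+ 2 * `|v| ^+ 2 =
     `|v| ^+ 2 * (`|u| ^+ 2 * `|v| ^+ 2 - inner u v ^+ 2) by ring.
  by rewrite pmulr_rge0 ?exprn_gt0// subr_ge0.
by rewrite -ler_sqr ?nnegrE ?mulr_ge0// real_normK ?num_real.
Qed.

Lemma is_dual_inner u : is_dual (inner u : H -> R).
Proof.
split=> [a v w|v]; first by rewrite innerDr innerZr.
apply/cvgrPdist_lt => e e0.
have k0 : 0 < `|u| + 1 by rewrite ltr_wpDl.
apply: filterS (nbhsx_ballx v (e / (`|u| + 1)) (divr_gt0 e0 k0)) => w.
rewrite -ball_normE /ball_/= => vw; rewrite -innerBr.
apply: le_lt_trans (cauchy_schwarz _ _) _.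
rewrite (le_lt_trans (y := (`|u| + 1) * `|v - w|)) ?ler_wpM2r ?lerDl//.
by rewrite mulrC -ltr_pdivlMr.
Qed.

Lemma cvg_inner (s : nat -> H) u : s @ \oo --> u ->
  forall v, inner (s n) v @[n --> \oo] --> inner u v.
Proof.
move=> su v; have [_ /(_ u) c] := is_dual_inner v.
rewrite innerC; under eq_fun do rewrite innerC.
exact: (cvg_comp _ _ su c).
Qed.

Lemma cauchy_le_cvg (s : nat -> H) (e : nat -> R) :
  e @ \oo --> (0 : R) -> (forall n m, (n <= m)%N -> `|s n - s m| <= e n) ->
  cvg (s @ \oo).
Proof.
move=> e0 se; apply/cauchy_cvgP/cauchy_ballP => r r0.
have r20 : 0 < r / 2 by lra.
have /cvgrPdist_lt/(_ _ r20) [N _ eN] := e0.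
have {eN}: `|0 - e N| < r / 2 by apply: eN => /=.
rewrite sub0r normrN => /(le_lt_trans (ler_norm _)) eN.
exists ([set x | `|s N - x| < r / 2], [set x | `|s N - x| < r / 2]) => /=.
  by split; exists N => // n /= Nn; exact: le_lt_trans (se _ _ Nn) eN.
move=> [x y] /= [xN yN]; rewrite -ball_normE /ball_/=.
have -> : x - y = (s N - y) - (s N - x) by rewrite opprB [RHS]addrC addrA subrK.
rewrite (le_lt_trans (ler_normB _ _))//; lra.
Qed.

(** Minimising [|v|^2 - 2 phi v] over the subspace gives a minimising sequence
    that the parallelogram law makes Cauchy; the first variation at its limit
    [u] says that [u] represents [phi].  Taking [phi] bounded on all of the
    space yields the Riesz theorem, and [phi = inner f] the projection of [f] on
    the closure of [S]. *)
Lemma subspace_riesz (S : set H) (phi : H -> R) (C : R) :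
  S 0 -> (forall a u v, S u -> S v -> S (a *: u + v)) ->
  (forall a u v, S u -> S v -> phi (a *: u + v) = a * phi u + phi v) ->
  (forall v, S v -> `|phi v| <= C * `|v|) ->
  exists (s : nat -> H) (u : H),
    [/\ forall n, S (s n), s @ \oo --> u & forall v, S v -> phi v = inner u v].
Proof.
move=> S0 SL phiL phiC.
pose q v := `|v| ^+ 2 - 2 * phi v.
have q_ge v : S v -> - C ^+ 2 <= q v.
  move=> Sv; have := phiC _ Sv; rewrite ler_norml => /andP[_ h].
  have := sqr_ge0 (`|v| - C); rewrite /q sqrrB; lra.
pose Q := q @` S.
have Qinf : has_inf Q.
  split; first by exists (q 0), 0.
  by exists (- C ^+ 2) => _ [v Sv <-]; exact: q_ge.
have q_inf v : S v -> inf Q <= q v.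
  by move=> Sv; apply: ge_inf; [case: Qinf|exists v].
pose e n : R := n.+1%:R^-1.
have e_gt0 n : 0 < e n by rewrite /e invr_gt0 ltr0n.
have /choice[s sP] : forall n, exists v, S v /\ q v < inf Q + (e n / 2) ^+ 2.
  move=> n; have h : 0 < (e n / 2) ^+ 2 by rewrite exprn_gt0// divr_gt0.
  by have [_ [v Sv <-] qv] := inf_adherent h Qinf; exists v.
have SZ a v : S v -> S (a *: v).
  by move=> Sv; rewrite -[_ *: _]addr0; exact: SL.
have phi0 : phi 0 = 0.
  have := phiL 1 0 0 S0 S0; rewrite scaler0 addr0 mul1r; lra.
have phiZ a v : S v -> phi (a *: v) = a * phi v.
  by move=> Sv; have := phiL a v 0 Sv S0; rewrite addr0 phi0 addr0.
have sC n m : (n <= m)%N -> `|s n - s m| <= e n.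
  move=> nm; have [Sn qn] := sP n; have [Sm qm] := sP m.
  have emn : e m <= e n by rewrite /e lef_pV2 ?posrE ?ltr0n// ler_nat ltnS.
  have Smid : S (2^-1 *: s n + 2^-1 *: s m) by apply: SL => //; exact: SZ.
  have := q_inf _ Smid; rewrite /q phiL ?phiZ//; last exact: SZ.
  rewrite normD2 innerZl innerZr !normrZ gtr0_norm ?invr_gt0//.
  move: qn qm; rewrite /q => qn qm qi.
  have e2 : e m ^+ 2 <= e n ^+ 2.
    by rewrite ler_sqr ?nnegrE ?(ltW (e_gt0 _)).
  rewrite -ler_sqr ?nnegrE ?(ltW (e_gt0 _))// normB2.
  move: qn qm qi; rewrite !exprMn => *; lra.
have e0 : e @ \oo --> (0 : R) by exact: cvg_harmonic.
have /cvg_ex[u su] := cauchy_le_cvg e0 sC.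
exists s, u; split => // [n|v Sv]; first by have [] := sP n.
have key t : 0 <= t ^+ 2 * `|v| ^+ 2 + 2 * t * (inner u v - phi v).
  have c : ((e n / 2) ^+ 2 + t ^+ 2 * `|v| ^+ 2 +
      2 * t * (inner (s n) v - phi v)) @[n --> \oo] -->
      ((0 / 2) ^+ 2 + t ^+ 2 * `|v| ^+ 2 + 2 * t * (inner u v - phi v)).
    apply: cvgD; last first.
      apply: cvgM; first exact: cvg_cst.
      by apply: cvgB; [exact: cvg_inner|exact: cvg_cst].
    apply: cvgD; last exact: cvg_cst.
    have h : e n / 2 @[n --> \oo] --> (0 / 2 : R).
      by apply: cvgM => //; exact: cvg_cst.
    by rewrite !expr2; exact: (cvgM h h).
  have -> : t ^+ 2 * `|v| ^+ 2 + 2 * t * (inner u v - phi v) =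
     (0 / 2) ^+ 2 + t ^+ 2 * `|v| ^+ 2 + 2 * t * (inner u v - phi v).
    by rewrite mul0r expr0n/= add0r.
  apply: (cvgr_to_ge c); apply: nearW => n; have [Sn qn] := sP n.
  have := q_inf _ (SL t _ _ Sv Sn); rewrite /q phiL// normD2 innerZl normrZ.
  rewrite exprMn real_normK ?num_real//.
  move: qn; rewrite /q (innerC v); lra.
apply/eqP; rewrite eq_sym -subr_eq0; apply/eqP.
set b := inner u v - phi v in key *.
set N := `|v| ^+ 2 in key.
have N0 : 0 <= N by rewrite sqr_ge0.
(* this value of [t] makes the quadratic polynomial negative unless [b = 0] *)
have := key (- b / (N + 1)).
have N1 : N + 1 != 0 by rewrite gt_eqF// ltr_wpDl.
have -> : (- b / (N + 1)) ^+ 2 * N + 2 * (- b / (N + 1)) * b =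
  - (b ^+ 2 * ((N + 2) / (N + 1) ^+ 2)) by field.
rewrite oppr_ge0 pmulr_lle0 ?divr_gt0 ?exprn_gt0//; try lra.
by rewrite le_eqVlt ltNge sqr_ge0 orbF sqrf_eq0 => /eqP.
Qed.

Lemma is_dual_bounded (phi : H -> R) :
  is_dual phi -> exists C, forall v, `|phi v| <= C * `|v|.
Proof.
move=> [phiL phiC].
have phi0 : phi 0 = 0.
  by have := phiL 1 0 0; rewrite scaler0 addr0 /= /GRing.scale/=; lra.
have /cvgrPdist_lt/(_ 1 ltr01)/nbhs_ballP[d /= d0 dP] := phiC 0.
exists (2 / d) => v; have [->|v0] := eqVneq v 0; first by rewrite phi0 !normr0 mulr0.
have nv : 0 < `|v| by rewrite normr_gt0.
pose a := d / 2 / `|v|; have a0 : 0 < a by rewrite !divr_gt0.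
have : `|phi 0 - phi (a *: v)| < 1.
  apply: dP; rewrite -ball_normE /ball_/= sub0r normrN normrZ gtr0_norm//.
  by rewrite /a divfK ?gt_eqF//; lra.
have := phiL a v 0; rewrite /= addr0 phi0 addr0 => ->.
rewrite sub0r normrN normrM gtr0_norm// => /ltW.
have -> : 2 / d * `|v| = a^-1 by rewrite /a; field; rewrite !gt_eqF.
by rewrite -ler_pdivlMl// mulr1.
Qed.

Lemma riesz (phi : H -> R) : is_dual phi -> exists u, phi = inner u.
Proof.
move=> dphi; have [C phiC] := is_dual_bounded dphi.
have [s [u [_ _ uP]]] := @subspace_riesz setT phi C I (fun _ _ _ _ _ => I)
  (fun a u v _ _ => dphi.1 a u v) (fun v _ => phiC v).
by exists u; apply/funext => v; rewrite uP.
Qed.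

Lemma dual_norm_inner u : dual_norm (inner u : H -> R) = `|u|.
Proof.
rewrite /dual_norm; set A := (X in sup X).
have ubA : ubound A `|u|.
  move=> _ [f /= f1 <-]; apply: le_trans (cauchy_schwarz _ _) _.
  by rewrite ler_piMr.
have Au : A `|u|.
  have [->|u0] := eqVneq u 0.
    by exists 0; [rewrite /= normr0 ler01|rewrite inner0r !normr0].
  exists (`|u|^-1 *: u); rewrite /= ?normfZV//.
  by rewrite innerZr inner_norm expr2 mulKf ?normr_eq0// normr_id.
apply/eqP; rewrite eq_le; apply/andP; split.
  by apply: ge_sup => //; exists `|u|.
by apply: ub_le_sup => //; exists `|u|.
Qed.
End InnerProduct.

(** * Extending an isometry between total families *)

Section Unitary.
Context (R : realType).

(** The linear span of the graph [B] in the product space: the pairs of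
    corresponding combinations of the two families related by [B]. *)
Inductive paired_span (H1 H2 : hilbertType R) (B : H1 -> H2 -> Prop) :
    H1 -> H2 -> Prop :=
| paired_span0 : paired_span B 0 0
| paired_spanS a u1 u2 v1 v2 : B u1 u2 -> paired_span B v1 v2 ->
    paired_span B (a *: u1 + v1) (a *: u2 + v2).

Definition total_left (H1 H2 : hilbertType R) (B : H1 -> H2 -> Prop) :=
  forall f, (forall u v, B u v -> inner f u = 0) -> f = 0.

Definition isometric_rel (H1 H2 : hilbertType R) (B : H1 -> H2 -> Prop) :=
  forall u1 u2 v1 v2, B u1 u2 -> B v1 v2 -> inner u1 v1 = inner u2 v2.

Definition unitary (H1 H2 : hilbertType R) (U : H1 -> H2) :=
  [/\ bijective U, linear U & forall f g, inner (U f) (U g) = inner f g].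

Section Transfer.
Context (H1 H2 : hilbertType R) (B : H1 -> H2 -> Prop).
Context (isoB : isometric_rel B) (tot1 : total_left B).

Lemma paired_span_lin a u1 u2 v1 v2 : paired_span B u1 u2 -> paired_span B v1 v2 ->
  paired_span B (a *: u1 + v1) (a *: u2 + v2).
Proof.
move=> s1 s2; elim: s1 => [|b x1 x2 y1 y2 Bx _ ih]; first by rewrite !scaler0 !add0r.
by rewrite !scalerDr !scalerA -!addrA; apply: paired_spanS.
Qed.

Lemma paired_span_inner u1 u2 v1 v2 : paired_span B u1 u2 -> paired_span B v1 v2 ->
  inner u1 v1 = inner u2 v2.
Proof.
elim=> [|a x1 x2 y1 y2 Bx _ ihy] sv; first by rewrite !inner0l.
rewrite !innerDl !innerZl ihy//; congr (_ * _ + _).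
elim: sv => [|b z1 z2 w1 w2 Bz _ ihw]; first by rewrite !inner0r.
by rewrite !innerDr !innerZr ihw (isoB Bx Bz).
Qed.

(** [f] is the limit of combinations of the first family; the corresponding
    combinations of the second one are at the same mutual distances, hence
    converge as well, and their limit is [g]. *)
Lemma isometric_rel_transfer f : exists g,
  `|g| = `|f| /\ forall u v, B u v -> inner f u = inner g v.
Proof.
pose S := [set u | exists v, paired_span B u v].
have [||||s [f' [Ss sf fP]]] := @subspace_riesz R H1 S (inner f) `|f|.
- by exists 0; exact: paired_span0.
- by move=> a u v [u' Bu] [v' Bv]; exists (a *: u' + v'); exact: paired_span_lin.
- by move=> a u v _ _; rewrite innerDr innerZr.
- by move=> v _; exact: cauchy_schwarz.
have SB u v : B u v -> paired_span B u v.
  by move=> Bu; rewrite -[u]addr0 -[v]addr0 -[u]scale1r -[v]scale1r;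
     apply: paired_spanS => //; exact: paired_span0.
have ff' : f = f'.
  apply/eqP; rewrite -subr_eq0; apply/eqP/tot1 => u v Bu.
  by rewrite innerBl fP ?subrr//; exists v; exact: SB.
rewrite -{}ff' {f' fP} in sf.
have /choice[t st] : forall n, exists v, paired_span B (s n) v := Ss.
have span2B u1 u2 v1 v2 : paired_span B u1 u2 -> paired_span B v1 v2 ->
    paired_span B (u1 - v1) (u2 - v2).
  by move=> h k; rewrite addrC [u2 - v2]addrC -scaleN1r -[- v2]scaleN1r;
     exact: paired_span_lin.
have span2_norm u v : paired_span B u v -> `|v| = `|u|.
  move=> h; have := paired_span_inner h h; rewrite !inner_norm => /eqP.
  by rewrite eqrXn2// => /eqP.
have /cvg_ex[g tg] : cvg (t @ \oo).
  apply/cauchy_cvgP/cauchy_ballP => e e0.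
  have /cauchy_cvgP/cauchy_ballP/(_ e e0) : cvg (s @ \oo).
    by apply/cvg_ex; exists f.
  move=> [[P Q] [sP sQ] PQ].
  exists (t @` (s @^-1` P), t @` (s @^-1` Q)).
    split.
      by apply: (@filterS _ \oo _ (s @^-1` P) _ _ sP) => n Pn; exists n.
    by apply: (@filterS _ \oo _ (s @^-1` Q) _ _ sQ) => n Qn; exists n.
  move=> [_ _] [[n Pn <-] [m Qm <-]] /=.
  have := PQ (s n, s m) (conj Pn Qm); rewrite /= -!ball_normE /ball_/=.
  by rewrite (span2_norm _ _ (span2B _ _ _ _ (st n) (st m))).
exists g; split => [|u v Bu].
  have c1 : `|s n| @[n --> \oo] --> `|f| by exact: cvg_norm.
  have c2 : `|t n| @[n --> \oo] --> `|g| by exact: cvg_norm.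
  apply: (norm_cvg_unique c2); rewrite /=.
  by rewrite (_ : (fun n => `|t n|) = fun n => `|s n|)//;
     apply/funext => n; rewrite (span2_norm _ _ (st n)).
have c1 := @cvg_inner _ _ _ _ sf u; have c2 := @cvg_inner _ _ _ _ tg v.
apply: (norm_cvg_unique c1); rewrite /=.
rewrite (_ : (fun n => inner (s n) u) = fun n => inner (t n) v)//.
by apply/funext => n; rewrite (paired_span_inner (st n) (SB _ _ Bu)).
Qed.

End Transfer.

(** The transfer of vectors works in both directions, and a vector is determined
    by its inner products with a total family; linearity and invertibility of the
    resulting maps follow from this uniqueness. *)
Lemma isometric_rel_unitary (H1 H2 : hilbertType R) (B : H1 -> H2 -> Prop) :
  isometric_rel B -> total_left B -> total_left (fun v u => B u v) ->
  exists U : H1 -> H2, unitary U /\ forall u v, B u v -> U u = v.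
Proof.
move=> isoB tot1 tot2.
have isoB' : isometric_rel (fun v u => B u v).
  by move=> u1 u2 v1 v2 Bu Bv; rewrite (isoB _ _ _ _ Bu Bv).
have /choice[U UP] := isometric_rel_transfer isoB tot1.
have /choice[V VP] := isometric_rel_transfer isoB' tot2.
have UE f u v : B u v -> inner (U f) v = inner f u.
  by move=> Bu; rewrite ((UP f).2 u v Bu).
have VE f u v : B u v -> inner (V f) u = inner f v.
  by move=> Bu; rewrite ((VP f).2 v u Bu).
have eq2 g g' : (forall u v, B u v -> inner g v = inner g' v) -> g = g'.
  move=> h; apply/eqP; rewrite -subr_eq0; apply/eqP/tot2 => v u Bu.
  by rewrite innerBl (h _ _ Bu) subrr.
have eq1 g g' : (forall u v, B u v -> inner g u = inner g' u) -> g = g'.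
  move=> h; apply/eqP; rewrite -subr_eq0; apply/eqP/tot1 => u v Bu.
  by rewrite innerBl (h _ _ Bu) subrr.
have UL : linear U.
  move=> a f g; apply: eq2 => u v Bu; rewrite innerDl innerZl.
  by rewrite !(UE _ _ _ Bu) innerDl innerZl.
exists U; split; first split=> //.
- exists V => f; first by apply: eq1 => u v Bu; rewrite (VE _ _ _ Bu) (UE _ _ _ Bu).
  by apply: eq2 => u v Bu; rewrite (UE _ _ _ Bu) (VE _ _ _ Bu).
- move=> f g; have := UL 1 f g; rewrite !scale1r !innerE => <-.
  by rewrite !(UP _).1.
- move=> u v Bu; apply: eq2 => u' v' Bu'.
  by rewrite (UE _ _ _ Bu') (isoB _ _ _ _ Bu Bu').
Qed.

End Unitary.

(** * Square integrable functions and the Riesz-Fischer theorem *)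

Section SquareIntegrable.
Context d (X : measurableType d) (R : realType).
Context (mu : {measure set X -> \bar R}) (D : set X) (mD : measurable D).
Implicit Types f g h : X -> R.

Definition sqint f :=
  measurable_fun D f /\ (\int[mu]_(x in D) (f x ^+ 2)%:E < +oo)%E.

Definition sqdot f g : R := \int[mu]_(x in D) (f x * g x).

Lemma measurable_EFin_sqr f : measurable_fun D f ->
  measurable_fun D (fun x => (f x ^+ 2)%:E).
Proof. by move=> mf; apply/measurable_EFinP; exact: measurable_funX. Qed.

Lemma sqint_integrable f : sqint f -> mu.-integrable D (EFin \o (f \* f)).
Proof.
move=> [mf f2]; apply/integrableP; split.
  by apply/measurable_EFinP; exact: measurable_funM.
rewrite (eq_integral (fun x => (f x ^+ 2)%:E))// => x _ /=.
by rewrite ger0_norm -?expr2 ?sqr_ge0.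
Qed.

Lemma sqint_mul_integrable f g : sqint f -> sqint g ->
  mu.-integrable D (EFin \o (f \* g)).
Proof.
move=> sf sg.
apply: (@le_integrable _ _ _ _ _ mD _
  (fun x => (f x * f x)%:E + (g x * g x)%:E)%E) => //.
- by apply/measurable_EFinP; apply: measurable_funM; [case: sf|case: sg].
- move=> x Dx /=; rewrite lee_fin.
  apply: le_trans (ler_norm _); rewrite normrM -!expr2.
  rewrite -[f x ^+ 2]real_normK ?num_real// -[g x ^+ 2]real_normK ?num_real//.
  have := sqr_ge0 (`|f x| - `|g x|); rewrite sqrrB.
  have := sqr_ge0 (`|f x|); have := sqr_ge0 (`|g x|); lra.
- by apply: integrableD => //; exact: sqint_integrable.
Qed.

Lemma sqint0 : sqint (fun=> 0).
Proof.
split; first exact: measurable_cst.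
by rewrite integral0_eq// => x _; rewrite expr0n.
Qed.

Lemma sqint_lin a f g : sqint f -> sqint g -> sqint (fun x => a * f x + g x).
Proof.
move=> sf sg.
have mfg : measurable_fun D (fun x => a * f x + g x).
  apply: measurable_funD; last by case: sg.
  by apply: measurable_funM => //; case: sf.
split => //.
have i1 := integrableZl mD (a ^+ 2) (sqint_integrable sf).
have i2 := integrableZl mD (2 * a) (sqint_mul_integrable sf sg).
have i3 := sqint_integrable sg.
have := integrable_lty mD (integrableD mD (integrableD mD i1 i2) i3).
congr (_ < _)%E; apply: eq_integral => x _ /=.
by rewrite -!EFinM -!EFinD; congr EFin; ring.
Qed.

Lemma sqint_diff f g : sqint f -> sqint g -> sqint (fun x => f x - g x).
Proof.
move=> sf sg; have := sqint_lin (- 1) sg sf.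
by congr sqint; apply/funext => x; rewrite mulN1r addrC.
Qed.

Lemma sqdotC f g : sqdot f g = sqdot g f.
Proof. by apply: eq_Rintegral => x _; rewrite mulrC. Qed.

Lemma sqdot_lin a f g h : sqint f -> sqint g -> sqint h ->
  sqdot (fun x => a * f x + g x) h = a * sqdot f h + sqdot g h.
Proof.
move=> sf sg sh; have ifh := sqint_mul_integrable sf sh.
have igh := sqint_mul_integrable sg sh.
rewrite /sqdot -RintegralZl// -RintegralD//.
  by apply: eq_Rintegral => x _; ring.
exact: (integrableZl mD a ifh).
Qed.

Lemma sqdot_ge0 f : 0 <= sqdot f f.
Proof. by apply: Rintegral_ge0 => x _; rewrite -expr2 sqr_ge0. Qed.

Lemma EFin_sqdot f : sqint f ->
  (sqdot f f)%:E = (\int[mu]_(x in D) (f x ^+ 2)%:E)%E.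
Proof.
move=> sf; rewrite /sqdot /Rintegral fineK; first by under eq_integral do rewrite -expr2.
by apply: integrable_fin_num => //; exact: sqint_integrable.
Qed.

Lemma sqdot_eq0 f : sqint f -> sqdot f f = 0 -> ae_eq mu D f (fun=> 0).
Proof.
move=> sf f0; have [mf _] := sf.
have : ae_eq mu D (fun x => (f x ^+ 2)%:E) (cst 0%E).
  apply/ae_eq_integral_abs => //; first exact: measurable_EFin_sqr.
  rewrite -[RHS](congr1 EFin f0) EFin_sqdot//; apply: eq_integral => x _.
  by rewrite gee0_abs// lee_fin sqr_ge0.
apply: filterS => x /= h Dx; have [/eqP] := h Dx.
by rewrite sqrf_eq0 => /eqP.
Qed.

Lemma ae_eq_sqdot f f' g : sqint f -> sqint f' -> sqint g ->
  ae_eq mu D f f' -> sqdot f g = sqdot f' g.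
Proof.
move=> [mf _] [mf' _] [mg _] ff'; congr fine; apply: ae_eq_integral => //.
- by apply/measurable_EFinP; exact: measurable_funM.
- by apply/measurable_EFinP; exact: measurable_funM.
- by apply: filterS ff' => x h Dx; rewrite h.
Qed.

Lemma sqint_ae f g : sqint f -> measurable_fun D g -> ae_eq mu D f g -> sqint g.
Proof.
move=> [mf f2] mg fg; split => //; apply: le_lt_trans f2.
rewrite le_eqVlt; apply/orP; left; apply/eqP.
apply: ae_eq_integral => //; try exact: measurable_EFin_sqr.
by apply: filterS fg => x h Dx; rewrite h.
Qed.

(** Riesz-Fischer for rapidly Cauchy sequences.  The series of the
    [2^n (f_(n+1) - f_n)^2] has a finite integral, hence is finite almost
    everywhere; since [d <= 2^-n + 2^n d^2], the increments are then summable, so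
    [f_n] converges almost everywhere, and Fatou's lemma bounds the distance to
    the limit. *)
Lemma riesz_fischer (f_ : nat -> X -> R) : (forall n, sqint (f_ n)) ->
  (forall n m, (n <= m)%N ->
     sqdot (fun x => f_ m x - f_ n x) (fun x => f_ m x - f_ n x) <= 4^-1 ^+ n) ->
  exists2 f, sqint f & forall n,
     sqdot (fun x => f x - f_ n x) (fun x => f x - f_ n x) <= 4^-1 ^+ n.
Proof.
move=> sf cf.
have mf n : measurable_fun D (f_ n) by case: (sf n).
have sum_half_le2 n : \sum_(0 <= i < n) 2^-1 ^+ i <= 2 :> R.
  have := @geometric_le_lim R n 1 2^-1 ler01; rewrite ger0_norm//.
  have -> : 1 * (1 - 2^-1)^-1 = 2 :> R by field.
  move=> h; apply: le_trans (h _ _); rewrite ?invf_lt1 ?ltr1n//.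
  rewrite /series/= le_eqVlt; apply/orP; left; apply/eqP.
  by apply: eq_bigr => i _; rewrite mul1r.
pose dd n x := f_ n.+1 x - f_ n x.
(* the weights [2^n] still leave a convergent series of integrals, as the squared
   norm of [dd n] is at most [4^-n] *)
pose u n x : \bar R := (2 ^+ n * dd n x ^+ 2)%:E.
have u0 n x : (0 <= u n x)%E by rewrite lee_fin mulr_ge0 ?sqr_ge0// exprn_ge0.
have mdd n : measurable_fun D (dd n) by apply: measurable_funB.
have mu_ n : measurable_fun D (u n).
  by apply/measurable_EFinP; apply: measurable_funM => //; exact: measurable_funX.
pose G x := (\sum_(n <oo) u n x)%E.
have mG : measurable_fun D G by apply: ge0_emeasurable_sum.
have iG : (\int[mu]_(x in D) G x < +oo)%E.
  rewrite integral_nneseries//.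
  have le2 n : (\int[mu]_(x in D) u n x <= (2^-1 ^+ n)%:E)%E.
    have -> : (\int[mu]_(x in D) u n x = (2 ^+ n * sqdot (dd n) (dd n))%:E)%E.
      rewrite EFinM EFin_sqdot; last exact: sqint_diff.
      rewrite -ge0_integralZl_EFin ?exprn_ge0//.
        by move=> x _; rewrite lee_fin sqr_ge0.
      exact: measurable_EFin_sqr.
    rewrite lee_fin -[leRHS]mul1r.
    have -> : 1 * 2^-1 ^+ n = 2 ^+ n * 4^-1 ^+ n :> R.
      by rewrite mul1r -exprMn; congr (_ ^+ _); lra.
    by rewrite ler_wpM2l ?exprn_ge0//; exact: cf.
  apply: (@le_lt_trans _ _ (\sum_(n <oo) (2^-1 ^+ n)%:E)%E).
    by apply: lee_nneseries => // n _ _; apply: integral_ge0.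
  apply: (@le_lt_trans _ _ 2%:E%E); last exact: ltry.
  apply: lime_le; first by apply: is_cvg_nneseries => n _ _; rewrite lee_fin exprn_ge0.
  by apply: nearW => n; rewrite sumEFin lee_fin; exact: sum_half_le2.
pose E := D `&` [set x | (G x < +oo)%E].
have mE : measurable E by apply: emeasurable_fun_infty_o.
have aeE : {ae mu, forall x, D x -> E x}.
  have : mu.-integrable D G.
    apply/integrableP; split => //; rewrite (eq_integral G)// => x _.
    by rewrite gee0_abs//; apply: nneseries_ge0.
  move/(integrable_ae mD); apply: filterS => x h Dx; split => //=.
  by have := h Dx; rewrite fin_numElt => /andP[].
pose g n := f_ n \_ E.
have mg n : measurable_fun D (g n).
  apply/measurable_restrict => //.
  exact: (measurable_funS mD (@subIsetl _ D E) (mf n)).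
have cg x : cvg (g n x @[n --> \oo]).
  have [xE|xE] := boolP (x \in E); last first.
    rewrite (_ : (fun n => _) = fun=> 0); first exact: is_cvg_cst.
    by apply/funext => n; rewrite /g /patch (negbTE xE).
  have [_ Gx] := set_mem xE.
  rewrite (_ : (fun n => _) = fun n => f_ 0 x + series (dd ^~ x) n); last first.
    apply/funext => n; rewrite /g /patch xE.
    exact: (eq_sum_telescope (f_ ^~ x) n).
  apply: is_cvgD; first exact: is_cvg_cst.
  apply: normed_cvg; apply: nondecreasing_is_cvgn.
    by apply: nondecreasing_series => n _ _; exact: normr_ge0.
  exists (2 + fine (G x)) => _ [n _ <-].
  apply: (@le_trans _ _ (\sum_(0 <= i < n) (2^-1 ^+ i + 2 ^+ i * dd i x ^+ 2))).
    apply: ler_sum => i _.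
    have p0 : 0 < 2 ^+ i :> R by rewrite exprn_gt0.
    rewrite exprVn -[X in _ + _ * X]real_normK ?num_real//.
    set t := `|_|; rewrite -subr_ge0.
    have -> : (2 ^+ i)^-1 + 2 ^+ i * t ^+ 2 - t =
       (2 ^+ i)^-1 * ((2 ^+ i * t - 2^-1) ^+ 2 + 3 / 4).
      by field; rewrite gt_eqF.
    by rewrite mulr_ge0 ?invr_ge0 ?(ltW p0)// addr_ge0 ?sqr_ge0//.
  rewrite big_split/= lerD//.
  rewrite -lee_fin fineK; last by rewrite ge0_fin_numE//; apply: nneseries_ge0.
  by rewrite -sumEFin; apply: nneseries_lim_ge => k _ _; exact: (u0 k x).
pose f x := lim (g n x @[n --> \oo]).
have mlim : measurable_fun D f by apply: measurable_fun_cvg mg _ => x _; exact: cg.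
have bound n : (\int[mu]_(x in D) ((f x - f_ n x) ^+ 2)%:E <= (4^-1 ^+ n)%:E)%E.
  pose F k x : \bar R := ((g (n + k)%N x - f_ n x) ^+ 2)%:E.
  have mF k : measurable_fun D (F k).
    by apply: measurable_EFin_sqr; apply: measurable_funB.
  have F0 k x : D x -> (0 <= F k x)%E by rewrite lee_fin sqr_ge0.
  have -> : (\int[mu]_(x in D) ((f x - f_ n x) ^+ 2)%:E =
             \int[mu]_(x in D) limn_einf (F ^~ x))%E.
    apply: eq_integral => x _; apply/esym.
    suff : F k x @[k --> \oo] --> ((f x - f_ n x) ^+ 2)%:E.
      by move=> /cvg_limn_einf_sup[].
    apply: cvg_EFin; first exact: nearW.
    have c : (g (n + k)%N x - f_ n x) @[k --> \oo] --> f x - f_ n x.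
      apply: cvgB; last exact: cvg_cst.
      have : g k x @[k --> \oo] --> f x by exact: cg.
      by rewrite -(cvg_shiftn n) /=; under eq_fun do rewrite addnC.
    rewrite expr2; rewrite (_ : _ \o _ = fun k =>
      (g (n + k)%N x - f_ n x) * (g (n + k)%N x - f_ n x)); first exact: (cvgM c c).
    by apply/funext => k; rewrite /F /= expr2.
  apply: le_trans (fatou mu mD mF F0) _.
  rewrite limn_einf_lim; apply: lime_le; first exact: is_cvg_einfs.
  apply: nearW => k; apply: (@le_trans _ _ (\int[mu]_(x in D) F k x)%E).
    by apply: ereal_inf_lbound; exists k => /=.
  have -> : (\int[mu]_(x in D) F k x =
      \int[mu]_(x in D) ((f_ (n + k)%N x - f_ n x) ^+ 2)%:E)%E.
    apply: ae_eq_integral => //.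
      by apply: measurable_EFin_sqr; apply: measurable_funB.
    apply: filterS aeE => x h Dx; rewrite /F /g /patch mem_set//; exact: h.
  by rewrite -EFin_sqdot ?lee_fin ?cf ?leq_addr//; exact: sqint_diff.
have sfB n : sqint (fun x => f x - f_ n x).
  split; first exact: measurable_funB.
  by apply: le_lt_trans (bound n) _; exact: ltry.
exists f => [|n]; last by rewrite -lee_fin EFin_sqdot.
have := sqint_lin 1 (sfB 0%N) (sf 0%N).
by congr sqint; apply/funext => x; rewrite mul1r subrK.
Qed.
End SquareIntegrable.

(** * The Hilbert space of classes of square integrable functions *)

Section L2space.
Local Open Scope quotient_scope.
Context d (X : measurableType d) (R : realType).
Context (mu : {measure set X -> \bar R}) (D : set X) (mD : measurable D).
Implicit Types f g h : X -> R.

Local Notation sqint := (sqint mu D).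
Local Notation sqdot := (sqdot mu D).

(** The quotient is taken on all functions, those that are not square integrable
    being sent to the class of [0]; this avoids a subtype. *)
Definition sq_clean f : X -> R := if `[< sqint f >] then f else fun=> 0.

Definition sq_eqv f g := `[< ae_eq mu D (sq_clean f) (sq_clean g) >].

Lemma sq_eqv_is_equiv : equiv_class_of sq_eqv.
Proof.
split=> [f|f g|g f h].
- by apply/asboolP; apply: ae_eq_refl.
- by apply/asbool_equiv_eq; split => /ae_eq_sym.
- by move=> /asboolP fg /asboolP gh; apply/asboolP; exact: ae_eq_trans fg gh.
Qed.

Canonical sq_eqv_equiv := EquivRelPack sq_eqv_is_equiv.
Canonical sq_eqv_encModRel := defaultEncModRel sq_eqv.

Definition L2space of measurable D := {eq_quot sq_eqv}.
Local Notation L := (L2space mD).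

HB.instance Definition _ := Choice.on L.

Definition L2class f : L := \pi_({eq_quot sq_eqv}) f.
Definition L2repr (u : L) : X -> R := sq_clean (repr (u : {eq_quot sq_eqv})).

Lemma sq_clean_id f : sqint f -> sq_clean f = f.
Proof. by move=> sf; rewrite /sq_clean asboolT. Qed.

Lemma sqint_clean f : sqint (sq_clean f).
Proof. by rewrite /sq_clean; case: asboolP => // _; exact: sqint0. Qed.

Lemma sqint_repr u : sqint (L2repr u). Proof. exact: sqint_clean. Qed.
Hint Resolve sqint_repr : core.

Lemma L2classP f g : sqint f -> sqint g ->
  L2class f = L2class g <-> ae_eq mu D f g.
Proof.
move=> sf sg; split.
  by move/eqP; rewrite /L2class eqmodE => /asboolP; rewrite !sq_clean_id.
by move=> fg; apply/eqP; rewrite /L2class eqmodE; apply/asboolP; rewrite !sq_clean_id.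
Qed.

Lemma L2reprK u : L2class (L2repr u) = u.
Proof.
rewrite -[RHS](reprK (u : {eq_quot sq_eqv})) /L2class; apply/eqP; rewrite eqmodE.
by apply/asboolP; rewrite (sq_clean_id (sqint_repr u)); exact: ae_eq_refl.
Qed.

Lemma L2classK f : sqint f -> ae_eq mu D (L2repr (L2class f)) f.
Proof. by move=> sf; apply/L2classP => //; rewrite L2reprK. Qed.

(** All operations are instances of this one, so that a single lemma, [L2linE],
    reduces the module axioms to pointwise identities. *)
Definition L2lin (a : R) (u v : L) : L :=
  L2class (fun x => a * L2repr u x + L2repr v x).

Lemma L2linE a f g : sqint f -> sqint g ->
  L2lin a (L2class f) (L2class g) = L2class (fun x => a * f x + g x).
Proof.
move=> sf sg; apply/L2classP; try exact: sqint_lin.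
have := L2classK sf; have := L2classK sg.
by apply: filterS2 => x hg hf Dx; rewrite hg// hf.
Qed.

Lemma L2ind (P : L -> Prop) : (forall f, sqint f -> P (L2class f)) -> forall u, P u.
Proof. by move=> h u; rewrite -[u]L2reprK; exact: h. Qed.

Definition L2zero : L := L2class (fun=> 0).
Definition L2add (u v : L) := L2lin 1 u v.
Definition L2opp (u : L) := L2lin (-1) u L2zero.
Definition L2scale a (u : L) := L2lin a u L2zero.

Let s0 : sqint (fun=> 0) := sqint0 mu D.
Hint Resolve s0 : core.

Let addA : associative L2add.
Proof.
elim/L2ind=> f sf; elim/L2ind=> g sg; elim/L2ind=> h sh.
rewrite /L2add !L2linE//; try exact: sqint_lin.
by congr L2class; apply/funext => x; ring.
Qed.

Let addC : commutative L2add.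
Proof.
elim/L2ind=> f sf; elim/L2ind=> g sg; rewrite /L2add !L2linE//.
by congr L2class; apply/funext => x; ring.
Qed.

Let add0 : left_id L2zero L2add.
Proof.
elim/L2ind=> f sf; rewrite /L2add !L2linE//.
by congr L2class; apply/funext => x; ring.
Qed.

Let addN : left_inverse L2zero L2opp L2add.
Proof.
elim/L2ind=> f sf; rewrite /L2add /L2opp (L2linE (-1) sf s0) L2linE//.
  by congr L2class; apply/funext => x; ring.
exact: sqint_lin.
Qed.

HB.instance Definition _ := GRing.isZmodule.Build L addA addC add0 addN.

Let scaleA a b v : L2scale a (L2scale b v) = L2scale (a * b) v.
Proof.
elim/L2ind: v => f sf; rewrite /L2scale (L2linE b sf s0) !L2linE//; last exact: sqint_lin.
by congr L2class; apply/funext => x; ring.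
Qed.

Let scale1 : left_id 1 L2scale.
Proof.
elim/L2ind=> f sf; rewrite /L2scale !L2linE//.
by congr L2class; apply/funext => x; ring.
Qed.

Let scaleDr : right_distributive L2scale +%R.
Proof.
move=> a; elim/L2ind=> f sf; elim/L2ind=> g sg.
rewrite /L2scale /GRing.add/= /L2add (L2linE 1 sf sg).
rewrite (L2linE a sf s0) (L2linE a sg s0) !L2linE//; try exact: sqint_lin.
by congr L2class; apply/funext => x; ring.
Qed.

Let scaleDl v : {morph L2scale^~ v: a b / a + b}.
Proof.
move=> a b; elim/L2ind: v => f sf.
rewrite /L2scale {2}/GRing.add/= /L2add (L2linE a sf s0) (L2linE b sf s0).
rewrite !L2linE//; try exact: sqint_lin.
by congr L2class; apply/funext => x; ring.
Qed.

HB.instance Definition _ :=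
  GRing.Zmodule_isLmodule.Build R L scaleA scale1 scaleDr scaleDl.

Lemma L2class_lin a f g : sqint f -> sqint g ->
  L2class (fun x => a * f x + g x) = a *: L2class f + L2class g.
Proof.
move=> sf sg; rewrite /GRing.scale/= /L2scale /GRing.add/= /L2add (L2linE a sf s0) L2linE//.
  by congr L2class; apply/funext => x; rewrite mul1r addr0.
exact: sqint_lin.
Qed.

Definition L2inner (u v : L) : R := sqdot (L2repr u) (L2repr v).

Lemma L2innerE f g : sqint f -> sqint g ->
  L2inner (L2class f) (L2class g) = sqdot f g.
Proof.
move=> sf sg; rewrite /L2inner.
rewrite (ae_eq_sqdot mD _ sf _ (L2classK sf))//.
by rewrite sqdotC (ae_eq_sqdot mD _ sg _ (L2classK sg))// sqdotC.
Qed.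

Definition L2norm_of_inner (u : L) : R := Num.sqrt (L2inner u u).

Let inC u v : L2inner u v = L2inner v u. Proof. exact: sqdotC. Qed.

Let inP a u v x : L2inner (a *: u + v) x = a * L2inner u x + L2inner v x.
Proof.
elim/L2ind: u => f sf; elim/L2ind: v => g sg; elim/L2ind: x => h sh.
by rewrite -L2class_lin// !L2innerE ?sqdot_lin//; exact: sqint_lin.
Qed.

Let in_ge0 u : 0 <= L2inner u u. Proof. exact: sqdot_ge0. Qed.

Let in_eq0 u : L2inner u u = 0 -> u = 0.
Proof.
elim/L2ind: u => f sf; rewrite L2innerE// => /(sqdot_eq0 mD sf) f0.
exact/L2classP.
Qed.

Let in0 x : L2inner 0 x = 0.
Proof. by have := inP 1 0 0 x; rewrite scaler0 addr0; lra. Qed.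

Let nrm2 u : L2norm_of_inner u ^+ 2 = L2inner u u. Proof. by rewrite sqr_sqrtr. Qed.

Let inE u v t : L2inner (t *: u + v) (t *: u + v) =
  t ^+ 2 * L2inner u u + 2 * t * L2inner u v + L2inner v v.
Proof. by rewrite inP (inC u) (inC v) !inP (inC v u); ring. Qed.

Let in_CS u v : L2inner u v <= L2norm_of_inner u * L2norm_of_inner v.
Proof.
have [/in_eq0 ->|v0] := eqVneq (L2inner v v) 0.
  by rewrite inC in0 mulr_ge0 ?sqrtr_ge0.
have vp : 0 < L2inner v v by rewrite lt_def v0 in_ge0.
have h : L2inner u v ^+ 2 <= L2inner u u * L2inner v v.
  have := in_ge0 (- (L2inner u v / L2inner v v) *: v + u).
  rewrite inE (inC v u) => /mulr_ge0/(_ (ltW vp)) h.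
  rewrite -subr_ge0; apply: le_trans h _.
  by rewrite le_eqVlt; apply/orP; left; apply/eqP; field.
rewrite (le_trans (ler_norm _))// -ler_sqr ?nnegrE ?mulr_ge0 ?sqrtr_ge0//.
by rewrite exprMn !nrm2 real_normK ?num_real.
Qed.

Let nrmD u v : L2norm_of_inner (u + v) <= L2norm_of_inner u + L2norm_of_inner v.
Proof.
rewrite -ler_sqr ?nnegrE ?addr_ge0 ?sqrtr_ge0// sqrrD !nrm2.
have := inE u v 1; rewrite scale1r => ->.
have := in_CS u v; lra.
Qed.

Let nrmZ a u : L2norm_of_inner (a *: u) = `|a| * L2norm_of_inner u.
Proof.
apply/eqP; rewrite -(eqrXn2 (n := 2))// ?mulr_ge0 ?sqrtr_ge0//.
rewrite exprMn !nrm2 real_normK ?num_real//.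
have := inE u 0 a; rewrite addr0 => ->.
by rewrite inC !in0; apply/eqP; ring.
Qed.

Let nrm_eq0 u : L2norm_of_inner u = 0 -> u = 0.
Proof. by move=> u0; apply: in_eq0; rewrite -nrm2 u0 expr0n. Qed.

HB.instance Definition _ := @Lmodule_isNormed.Build R L L2norm_of_inner nrmD nrmZ nrm_eq0.

Lemma L2norm_sqr (u : L) : L2inner u u = `|u| ^+ 2.
Proof. by rewrite -nrm2. Qed.

Lemma L2class_repr_diff u v : u - v = L2class (fun x => L2repr u x - L2repr v x).
Proof.
rewrite -[in LHS](L2reprK u) -[in LHS](L2reprK v) addrC -scaleN1r -L2class_lin//.
by congr L2class; apply/funext => x; ring.
Qed.

(** A Cauchy filter is close to a sequence of centres of balls of radii [2^-n / 2],
    to which Riesz-Fischer applies. *)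
Lemma L2_complete (F : set_system L) : ProperFilter F -> cauchy F -> cvg F.
Proof.
move=> FF /cauchyP cF.
have r_gt0 n : 0 < 2^-1 ^+ n / 2 :> R by rewrite divr_gt0// exprn_gt0.
have /choice[s sP] : forall n, exists u : L, F (ball u (2^-1 ^+ n / 2)).
  by move=> n; have [u Fu] := cF _ (r_gt0 n); exists u.
have s_cauchy n m : (n <= m)%N -> `|s m - s n| <= 2^-1 ^+ n.
  move=> nm; have [z []] := filter_ex (filterI (sP n) (sP m)).
  rewrite -!ball_normE /ball_/= => zn zm.
  have -> : s m - s n = (s m - z) - (s n - z) by rewrite opprB addrA subrK.
  have h : 2^-1 ^+ m <= 2^-1 ^+ n :> R by rewrite ler_wiXn2l ?invr_ge0 ?invf_le1 ?ler1n.
  rewrite (le_trans (ler_normB _ _))//; lra.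
have q2 n : (2^-1 ^+ n) ^+ 2 = 4^-1 ^+ n :> R.
  by rewrite exprAC; congr (_ ^+ _); field.
have [n|n m nm|f sf fP] := @riesz_fischer _ _ _ mu D mD (fun n => L2repr (s n)).
- exact: sqint_repr.
- rewrite -L2innerE; try exact: sqint_diff.
  by rewrite -L2class_repr_diff L2norm_sqr -q2 ler_sqr ?nnegrE ?exprn_ge0// s_cauchy.
have lims n : `|L2class f - s n| <= 2^-1 ^+ n.
  rewrite -ler_sqr ?nnegrE ?exprn_ge0// q2 -L2norm_sqr.
  have -> : L2class f - s n = L2class (fun x => f x - L2repr (s n) x).
    rewrite L2class_repr_diff; apply/L2classP; try exact: sqint_diff.
    by have := L2classK sf; apply: filterS => x h Dx; rewrite h.
  by rewrite L2innerE ?fP//; exact: sqint_diff.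
apply/cvg_ex; exists (L2class f); apply/cvg_ballP => e e0.
have [n ne] : exists n, 2^-1 ^+ n < e / 2 :> R.
  have /cvgrPdist_lt/(_ _ (divr_gt0 e0 (ltr0Sn _ 1)))[N _ NP] :
      geometric 1 2^-1 n @[n --> \oo] --> (0 : R).
    by apply: cvg_geometric; rewrite ger0_norm// invf_lt1// ltr1n.
  exists N; have := NP N (leqnn N).
  by rewrite /= mul1r sub0r normrN ger0_norm ?exprn_ge0//; exact.
apply: filterS (sP n) => z; rewrite -!ball_normE /ball_/= => zn.
have -> : L2class f - z = (L2class f - s n) + (s n - z) by rewrite addrA subrK.
rewrite (le_lt_trans (ler_normD _ _))//; have := lims n; lra.
Qed.

HB.instance Definition _ := Uniform_isComplete.Build L L2_complete.

HB.instance Definition _ :=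
  NormedModule_hasInner.Build R L inC inP L2norm_sqr.

Lemma L2norm_class f : sqint f -> `|L2class f| = Num.sqrt (sqdot f f).
Proof. by move=> sf; rewrite -L2innerE// L2norm_sqr sqrtr_sqr ger0_norm. Qed.

Lemma sqdot_cauchy_schwarz f g : sqint f -> sqint g ->
  `|sqdot f g| <= Num.sqrt (sqdot f f) * Num.sqrt (sqdot g g).
Proof.
by move=> sf sg; rewrite -L2innerE// -!L2norm_class//; exact: cauchy_schwarz.
Qed.

End L2space.

(** * Integration against a signed measure *)

Section ChargeIntegralTheory.
Context d (X : measurableType d) (R : realType).
Context (D : set X) (mD : measurable D).
Implicit Types (nu : {charge set X -> \bar R}) (m : {measure set X -> \bar R}).
Implicit Types (f : X -> R) (A : set X).

Local Notation jpos nu := (jordan_pos (hahnP nu)).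
Local Notation jneg nu := (jordan_neg (hahnP nu)).

Lemma jordanE nu A : measurable A -> (nu A = jpos nu A - jneg nu A)%E.
Proof. by move=> mA; rewrite (jordan_decomp (hahnP nu) mA)/= /cadd/= cscaleN1. Qed.

Lemma variationE nu A : variation nu A = (jpos nu A + jneg nu A)%E.
Proof. by []. Qed.

Lemma ge0_integral_variation nu (f : X -> \bar R) :
  (forall x, D x -> 0 <= f x)%E -> measurable_fun D f ->
  (\int[variation nu]_(x in D) f x =
   \int[jpos nu]_(x in D) f x + \int[jneg nu]_(x in D) f x)%E.
Proof.
move=> f0 mf; rewrite -ge0_integral_measure_add//.
by apply: eq_measure_integral => A _ _; exact: (esym (measure_addE _ _ A)).
Qed.

Lemma charge_integrableP nu f : charge_integrable nu D f <->
  (jpos nu).-integrable D (EFin \o f) /\ (jneg nu).-integrable D (EFin \o f).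
Proof.
have abs0 x : D x -> (0 <= `|(EFin \o f) x|)%E by [].
split=> [/integrableP[mf]|[/integrableP[mf fp] /integrableP[_ fn]]].
  have mabs : measurable_fun D (fun x => `|(EFin \o f) x|)%E.
    exact: measurableT_comp.
  rewrite ge0_integral_variation// => fi.
  by split; apply/integrableP; split => //; apply: le_lt_trans fi;
    rewrite ?leeDl ?leeDr// integral_ge0.
apply/integrableP; split => //; rewrite ge0_integral_variation//.
  by rewrite lte_add_pinfty.
exact: measurableT_comp.
Qed.

Lemma measure_sub_eq nu m1 m2 A : measurable A -> m1 A \is a fin_num ->
  m2 A \is a fin_num -> nu A = (m1 A - m2 A)%E ->
  (jpos nu A + m2 A = m1 A + jneg nu A)%E.
Proof.
move=> mA f1 f2; rewrite (jordanE nu mA).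
have := fin_num_measure (jpos nu) A mA; have := fin_num_measure (jneg nu) A mA.
move/fineK => <- /fineK <-; rewrite -(fineK f1) -(fineK f2).
by rewrite -!EFinD => -[h]; congr EFin; lra.
Qed.

(** The integral against a signed measure may be computed from any
    decomposition into two finite measures, not only from the Jordan one:
    [nu = m1 - m2] rearranges to the equality [nu^+ + m2 = m1 + nu^-] of
    positive measures. *)
Lemma charge_integral_sub nu m1 m2 f :
  (forall A, measurable A -> m1 A \is a fin_num) ->
  (forall A, measurable A -> m2 A \is a fin_num) ->
  (forall A, measurable A -> nu A = m1 A - m2 A)%E ->
  charge_integrable nu D f ->
  m1.-integrable D (EFin \o f) -> m2.-integrable D (EFin \o f) ->
  charge_integral nu D f = \int[m1]_(x in D) f x - \int[m2]_(x in D) f x.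
Proof.
move=> fin1 fin2 nuE /charge_integrableP[ip ine] i1 i2.
have : (\int[measure_add (jpos nu) m2]_(x in D) (f x)%:E =
        \int[measure_add m1 (jneg nu)]_(x in D) (f x)%:E)%E.
  apply: eq_measure_integral => A mA _.
  apply: etrans (measure_addE _ _ A) _; apply: etrans _ (esym (measure_addE _ _ A)).
  by apply: measure_sub_eq => //; [exact: fin1|exact: fin2|exact: nuE].
rewrite !integral_measure_add//.
have fp := integrable_fin_num mD ip; have fn := integrable_fin_num mD ine.
have f1 := integrable_fin_num mD i1; have f2 := integrable_fin_num mD i2.
rewrite /= in fp fn f1 f2.
rewrite -(fineK fp) -(fineK fn) -(fineK f1) -(fineK f2) -!EFinD => -[h].
rewrite /charge_integral /Rintegral; lra.
Qed.

Lemma charge_integral_cadd nu1 nu2 f :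
  charge_integrable nu1 D f -> charge_integrable nu2 D f ->
  charge_integrable (cadd nu1 nu2) D f ->
  charge_integral (cadd nu1 nu2) D f =
    charge_integral nu1 D f + charge_integral nu2 D f.
Proof.
move=> /charge_integrableP[p1 n1] /charge_integrableP[p2 n2] i12.
have fin m m' A : measurable A -> m A \is a fin_num -> m' A \is a fin_num ->
    measure_add m m' A \is a fin_num.
  by move=> mA h h'; rewrite [X in X \is a _](measure_addE _ _ A) fin_numD h.
have intadd m m' : m.-integrable D (EFin \o f) -> m'.-integrable D (EFin \o f) ->
    (measure_add m m').-integrable D (EFin \o f).
  move=> /integrableP[mf h] /integrableP[_ h'].
  apply/integrableP; split => //; rewrite ge0_integral_measure_add//.
    by rewrite lte_add_pinfty.
  exact: measurableT_comp.
have Radd m m' : m.-integrable D (EFin \o f) -> m'.-integrable D (EFin \o f) ->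
    \int[measure_add m m']_(x in D) f x =
    \int[m]_(x in D) f x + \int[m']_(x in D) f x.
  move=> h h'; rewrite /Rintegral integral_measure_add// -fineD//.
    exact: (integrable_fin_num mD h).
  exact: (integrable_fin_num mD h').
rewrite (@charge_integral_sub _ (measure_add (jpos nu1) (jpos nu2))
  (measure_add (jneg nu1) (jneg nu2)))//.
- by rewrite !Radd// /charge_integral; lra.
- by move=> A mA; apply: fin => //; exact: fin_num_measure.
- by move=> A mA; apply: fin => //; exact: fin_num_measure.
- move=> A mA; transitivity (nu1 A + nu2 A)%E => //.
  suff : (nu1 A + nu2 A = (jpos nu1 A + jpos nu2 A) - (jneg nu1 A + jneg nu2 A))%E.
    by move=> ->; congr (_ - _)%E; exact: (esym (measure_addE _ _ A)).
  rewrite (jordanE nu1 mA) (jordanE nu2 mA) fin_num_oppeD; last exact: fin_num_measure.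
  by rewrite addeACA.
- exact: intadd.
- exact: intadd.
Qed.

Lemma Rintegral_mscale m (k : {nonneg R}) f : m.-integrable D (EFin \o f) ->
  (mscale k m).-integrable D (EFin \o f) /\
  \int[mscale k m]_(x in D) f x = k%:num * \int[m]_(x in D) f x.
Proof.
move=> i; have /integrableP[mf fi] := i; split.
  apply/integrableP; split => //; rewrite ge0_integral_mscale//.
    by rewrite lte_mul_pinfty.
  exact: measurableT_comp.
rewrite /Rintegral integralE [in RHS]integralE.
have ip := integrable_funepos mD i; have ineg := integrable_funeneg mD i.
rewrite !ge0_integral_mscale//; try by case/integrableP: ip; case/integrableP: ineg.
rewrite -muleBr//; last by rewrite fin_num_adde_defr// integrable_fin_num.
by rewrite fineM// fin_numB !integrable_fin_num.
Qed.

Lemma charge_integral_cscale a nu f :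
  charge_integrable nu D f -> charge_integrable (cscale a nu) D f ->
  charge_integral (cscale a nu) D f = a * charge_integral nu D f.
Proof.
move=> /charge_integrableP[ip ine] ia.
have fins m (k : {nonneg R}) : (forall A, measurable A -> m A \is a fin_num) ->
    forall A, measurable A -> mscale k m A \is a fin_num.
  by move=> h A mA; rewrite fin_numM// h.
have finp A : measurable A -> jpos nu A \is a fin_num.
  by move=> mA; exact: fin_num_measure.
have finn A : measurable A -> jneg nu A \is a fin_num.
  by move=> mA; exact: fin_num_measure.
have [a0|a0] := leP 0 a.
  pose k := NngNum a0.
  have [i1 e1] := Rintegral_mscale k ip; have [i2 e2] := Rintegral_mscale k ine.
  rewrite (@charge_integral_sub _ (mscale k (jpos nu)) (mscale k (jneg nu)))//.
  - by rewrite e1 e2 /charge_integral/= mulrBr.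
  - exact: fins.
  - exact: fins.
  - move=> A mA; transitivity (a%:E * nu A)%E => //.
    by rewrite (jordanE nu mA) muleBr// fin_num_adde_defr// finp.
have a0' : 0 <= - a by rewrite oppr_ge0 ltW.
pose k := NngNum a0'.
have [i1 e1] := Rintegral_mscale k ip; have [i2 e2] := Rintegral_mscale k ine.
rewrite (@charge_integral_sub _ (mscale k (jneg nu)) (mscale k (jpos nu)))//.
- by rewrite e1 e2 /charge_integral/=; lra.
- exact: fins.
- exact: fins.
- move=> A mA; transitivity (a%:E * nu A)%E => //; rewrite (jordanE nu mA).
  transitivity ((- a)%:E * jneg nu A - (- a)%:E * jpos nu A)%E => //.
  have := finp _ mA; have := finn _ mA => /fineK <- /fineK <-.
  by rewrite -EFinB -!EFinM -EFinB; congr EFin; lra.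
Qed.

Lemma charge_integral_dirac (a : X) nu f : (forall A, nu A = \d_a A) ->
  D a -> charge_integrable nu D f -> charge_integral nu D f = f a.
Proof.
move=> nuE Da inu; have /charge_integrableP[/integrableP[mf _] _] := inu.
have ida : (@dirac _ X a R).-integrable D (EFin \o f).
  apply/integrableP; split => //; rewrite integral_dirac//.
    by rewrite diracE mem_set//= mul1e ltry.
  exact: measurableT_comp.
have i0 : (@mzero _ X R).-integrable D (EFin \o f).
  by apply/integrableP; split => //; rewrite integral_measure_zero.
rewrite (@charge_integral_sub _ (@dirac _ X a R) mzero)//.
- rewrite /Rintegral integral_dirac// integral_measure_zero.
  by rewrite diracE mem_set// mul1e /= subr0.
- by move=> A mA; rewrite nuE /mzero sube0.
Qed.

Lemma norm_charge_integral_le nu f : charge_integrable nu D f ->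
  (`|charge_integral nu D f|%:E <= \int[variation nu]_(x in D) `|f x|%:E)%E.
Proof.
move=> /charge_integrableP[ip ine].
have mf : measurable_fun D (fun x => `|f x|%:E).
  apply/measurable_EFinP; apply: measurableT_comp => //.
  by apply/measurable_EFinP; case/integrableP: ip.
rewrite ge0_integral_variation//.
apply: (@le_trans _ _ (`|\int[jpos nu]_(x in D) f x|%:E +
   `|\int[jneg nu]_(x in D) f x|%:E)%E); first by rewrite -EFinD lee_fin ler_normB.
apply: leeD; rewrite EFin_normr_Rintegral//; apply: le_abse_integral => //.
  by case/integrableP: ip.
by case/integrableP: ine.
Qed.

Lemma variation_null nu (F : set X) : measurable F ->
  (forall A, measurable A -> A `&` F = set0 -> nu A = 0) ->
  variation nu (~` F) = 0%E.
Proof.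
move=> mF h; rewrite variationE.
have mP : measurable (hahn_pos nu) by case: (hahnP nu) => -[].
have mN : measurable (hahn_neg nu) by case: (hahnP nu) => _ [].
have key B : measurable B -> nu (~` F `&` B) = 0%E.
  move=> mB; apply: h; first by apply: measurableI => //; exact: measurableC.
  by rewrite setIAC setICl set0I.
rewrite jordan_posE cjordan_posE jordan_negE cjordan_negE.
have mCF : measurable (~` F) by exact: measurableC.
by rewrite /crestr0 mem_set// /crestr/= !key// oppe0 adde0.
Qed.

End ChargeIntegralTheory.

(** * Duality and Fubini for square integrable kernels *)

(** The integral of a nonnegative function is the supremum of the integrals of the
    simple functions below it, and a larger function has more of them.  The lemma
    serves for the norms of [F x - s x] in a Bochner integral, whose measurability
    in [x] is not part of the definition. *)
Lemma ge0_le_integral_nonmeasurable d (X : measurableType d) (R : realType)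
    (m : {measure set X -> \bar R}) (D : set X) (f g : X -> \bar R) :
  (forall x, D x -> 0 <= f x)%E -> (forall x, D x -> f x <= g x)%E ->
  (\int[m]_(x in D) f x <= \int[m]_(x in D) g x)%E.
Proof.
move=> f0 fg; have g0 x : D x -> (0 <= g x)%E.
  by move=> Dx; exact: le_trans (f0 _ Dx) (fg _ Dx).
rewrite (ge0_integralE _ f0) (ge0_integralE _ g0).
apply: ereal_sup_le => _ [h hf <-]; exists h => // x; apply: le_trans (hf x) _.
by rewrite /patch; case: ifPn => // /set_mem; exact: fg.
Qed.

Section SquareIntegrableDuality.
Context (R : realType).
Local Notation rT := (measurableTypeR R).
Local Notation leb := (@lebesgue_measure R).
Local Notation P := (@posR R).

Lemma measurable_posR : measurable P.
Proof.
rewrite (_ : P = `]0, +oo[%classic); first exact: measurable_itv.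
by apply/seteqP; split => x /=; rewrite in_itv/= andbT.
Qed.
Hint Resolve measurable_posR : core.

(** Converse of the Cauchy-Schwarz inequality: testing against the truncations of
    [f], which are square integrable, bounds their norms by [C], and Fatou's lemma
    passes the bound to [f]. *)
Lemma sqint_of_bounded_pairing (f : rT -> R) (C : R) : measurable_fun P f ->
  (forall h, sqint leb P h ->
     `|sqdot leb P f h| <= C * Num.sqrt (sqdot leb P h h)) ->
  sqint leb P f.
Proof.
move=> mf fC; split => //.
pose I n : set rT := `[0, n%:R]%classic.
have mI n : measurable (I n) by exact: measurable_itv.
pose E n := P `&` [set x | `|f x| <= n%:R] `&` I n.
have mE n : measurable (E n).
  apply: measurableI => //.
  rewrite (_ : P `&` _ = P `&` [set x | (`|f x|%:E <= n%:R%:E :> \bar R)%E]); last first.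
    by apply/seteqP; split => x [Px /=]; rewrite lee_fin.
  apply: emeasurable_fun_infty_c => //.
  by apply/measurable_EFinP; apply: measurableT_comp.
pose g n := f \_ (E n).
have mg n : measurable_fun P (g n).
  apply/measurable_restrict => //.
  exact: (measurable_funS measurable_posR (@subIsetl _ P (E n)) mf).
have sg n : sqint leb P (g n).
  split => //.
  apply: (@le_lt_trans _ _ (\int[leb]_(x in P `&` I n) (n%:R ^+ 2)%:E)%E).
    rewrite integral_mkcondr; apply: ge0_le_integral => //.
    - by move=> x _; rewrite lee_fin sqr_ge0.
    - exact: measurable_EFin_sqr.
    - apply/measurable_restrict => //; exact: measurable_cst.
    - move=> x Px; rewrite /g /patch; case: ifPn => [/set_mem[[_ fn] xn]|_].
        rewrite mem_set// lee_fin -real_normK ?num_real// ler_sqr ?nnegrE//.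
      by case: ifPn => _; rewrite lee_fin expr0n//= sqr_ge0.
  rewrite integral_cst//; last exact: measurableI.
  rewrite lte_mul_pinfty ?lee_fin ?sqr_ge0//.
  apply: (@le_lt_trans _ _ (leb (I n))).
    by apply: le_measure; rewrite ?inE//; exact: measurableI.
  by rewrite /I lebesgue_measure_itv/=; case: ifP => _; rewrite ?ltry// EFinN -EFinD ltry.
have fg n x : f x * g n x = g n x * g n x.
  by rewrite /g /patch; case: ifPn => _; rewrite ?mulr0.
have gC n : sqdot leb P (g n) (g n) <= C ^+ 2.
  have := fC _ (sg n); rewrite /sqdot (_ : (fun x => f x * g n x) = fun x => g n x * g n x).
    set a := Rintegral _ _ _ => h; have a0 : 0 <= a by exact: sqdot_ge0.
    have {h} : a <= C * Num.sqrt a by rewrite -{1}(ger0_norm a0).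
    rewrite -{1 3}(sqr_sqrtr a0); set b := Num.sqrt a => h.
    have b0 : 0 <= b := sqrtr_ge0 _.
    have [b00|bn0] := eqVneq b 0; first by rewrite b00 expr0n sqr_ge0.
    have bp : 0 < b by rewrite lt_def bn0.
    move: h; rewrite expr2 ler_pM2r// => h.
    by rewrite ler_sqr ?nnegrE// (le_trans b0).
  by apply/funext => x.
have gf x : P x -> (g n x ^+ 2)%:E @[n --> \oo] --> (f x ^+ 2)%:E.
  move=> Px; apply: cvg_near_cst.
  have [N xN] : exists N : nat, Num.max x `|f x| <= N%:R.
    exists (Num.truncn (Num.max x `|f x|)).+1.
    by apply/ltW; rewrite truncnS_gt.
  exists N => // n /= Nn; rewrite /g /patch mem_set//.
  have nN : Num.max x `|f x| <= n%:R by rewrite (le_trans xN)// ler_nat.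
  move: nN; rewrite ge_max => /andP[xn fn].
  by split => //; rewrite /I /= in_itv/= xn andbT ltW.
apply: (@le_lt_trans _ _ (C ^+ 2)%:E); last exact: ltry.
rewrite (eq_integral (fun x => limn_einf (fun n => (g n x ^+ 2)%:E))); last first.
  by move=> x /set_mem Px; apply/esym; case: (cvg_limn_einf_sup (gf _ Px)).
apply: le_trans (fatou _ _ _ _) _ => //.
- by move=> n; exact: measurable_EFin_sqr.
- by move=> n x _; rewrite lee_fin sqr_ge0.
rewrite limn_einf_lim; apply: lime_le; first exact: is_cvg_einfs.
apply: nearW => k; apply: (@le_trans _ _ (\int[leb]_(x in P) (g k x ^+ 2)%:E)%E).
  by apply: ereal_inf_lbound; exists k => /=.
by rewrite -EFin_sqdot// lee_fin.
Qed.

End SquareIntegrableDuality.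

Lemma measurable_partial_Rintegral d1 d2 (X : measurableType d1)
    (Y : measurableType d2) (R : realType)
    (m : {sigma_finite_measure set Y -> \bar R}) (q : X * Y -> R) :
  measurable_fun setT q -> measurable_fun setT (fun x => \int[m]_y q (x, y)).
Proof.
move=> mq; have mq' : measurable_fun setT (EFin \o q) by exact/measurable_EFinP.
apply: (@measurableT_comp _ _ _ _ _ _ fine); first exact: fine_measurable.
rewrite (_ : (fun x => _) = fun x => (fubini_F m (EFin \o q)^\+ x -
    fubini_F m (EFin \o q)^\- x)%E); last first.
  apply/funext => x; rewrite integralE /fubini_F.
  by congr (_ - _)%E; apply: eq_integral => y _; rewrite ?funeposE ?funenegE.
apply: emeasurable_funB; apply: measurable_fun_fubini_tonelli_F => //.
  exact: measurable_funepos.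
exact: measurable_funeneg.
Qed.

Section SquareIntegrableKernel.
Context (R : realType).
Local Notation rT := (measurableTypeR R).
Local Notation leb := (@lebesgue_measure R).
Local Notation P := (@posR R).
Local Notation sqint := (sqint leb P).
Local Notation sqdot := (sqdot leb P).
Let mP : measurable P := @measurable_posR R.
Hint Resolve mP : core.

Context (F : rT -> rT -> R).
Context (mF : measurable_fun (P `*` P) (fun p : rT * rT => F p.1 p.2)).
Context (sF : forall x, P x -> sqint (F x)).

(** The extension by [0] of [F x t * h t], to which Fubini's theorem is applied on
    the whole plane. *)
Let q (h : rT -> R) (p : rT * rT) : R :=
  (((fun p : rT * rT => F p.1 p.2) \_ (P `*` P)) p * (h \_ P) p.2).

Let mPP : measurable (P `*` P : set (rT * rT)).
Proof. by apply: measurableX; exact: mP. Qed.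

Let mq h : measurable_fun P h -> measurable_fun setT (q h).
Proof.
move=> mh; apply: measurable_funM.
  by apply/(measurable_restrictT _ mPP); exact: mF.
have mhP : measurable_fun setT (h \_ P) by apply: (measurable_restrictT _ mP).1.
exact: (measurableT_comp mhP measurable_snd).
Qed.

Let qE h x : P x -> (fun t => q h (x, t)) = (fun t => F x t * h t) \_ P.
Proof.
move=> Px; apply/funext => t; rewrite /q /patch /=.
have [Pt|Pt] := boolP (t \in P).
  by rewrite mem_set//; split => //; exact: set_mem.
by rewrite mulr0.
Qed.

Let qE0 h x : ~ P x -> (fun t => q h (x, t)) = fun=> 0.
Proof.
move=> Px; apply/funext => t; rewrite /q /patch /= ifF ?mul0r//.
by apply/negP => /set_mem[].
Qed.

Lemma measurable_sqdot_kernel h : measurable_fun P h ->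
  measurable_fun P (fun x => sqdot (F x) h).
Proof.
move=> mh; have := measurable_partial_Rintegral leb (mq mh).
move=> /(measurable_funTS (D := P)); apply: eq_measurable_fun => x /set_mem Px.
rewrite /sqdot [RHS]Rintegral_mkcond; apply: eq_Rintegral => t _.
exact: (congr1 (fun u => u t) (qE h Px)).
Qed.

Definition kernel_norm x : R := Num.sqrt (sqdot (F x) (F x)).

Lemma measurable_kernel_norm : measurable_fun P kernel_norm.
Proof.
have ms : measurable_fun setT (Num.sqrt : R -> R).
  by apply: continuous_measurable_fun; exact: sqrt_continuous.
suff mg : measurable_fun P (fun x => sqdot (F x) (F x)).
  exact: (measurableT_comp ms mg).
pose q2 (p : rT * rT) : R := (((fun p : rT * rT => F p.1 p.2) \_ (P `*` P)) p) ^+ 2.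
have mq2 : measurable_fun setT q2.
  by apply: measurable_funX; apply/(measurable_restrictT _ mPP); exact: mF.
have := measurable_partial_Rintegral leb mq2.
move=> /(measurable_funTS (D := P)); apply: eq_measurable_fun => x /set_mem Px.
rewrite /sqdot [RHS]Rintegral_mkcond; apply: eq_Rintegral => t _.
rewrite /q2 /patch /=; have [Pt|Pt] := boolP (t \in P).
  by rewrite mem_set// ?expr2//; split => //; exact: set_mem.
by rewrite ifF ?expr0n//; apply/negP => /set_mem[_ /mem_set]; apply/negP.
Qed.

Lemma sqdot_kernel_le x h : P x -> sqint h ->
  `|sqdot (F x) h| <= kernel_norm x * Num.sqrt (sqdot h h).
Proof.
by move=> Px sh; exact: (sqdot_cauchy_schwarz mP (sF Px) sh).
Qed.

Section Measure.
Context (m : {finite_measure set rT -> \bar R}).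
Context (Nm : (\int[m]_(x in P) (kernel_norm x)%:E < +oo)%E).
Context (im : forall t, P t -> m.-integrable P (fun x => (F x t)%:E)).

Lemma integrable_sqdot_kernel h : sqint h ->
  m.-integrable P (fun x => (sqdot (F x) h)%:E).
Proof.
move=> sh; have [mh _] := sh.
apply: (@le_integrable _ _ _ _ _ mP _
  (fun x => (kernel_norm x * Num.sqrt (sqdot h h))%:E)) => //.
- by apply/measurable_EFinP; exact: measurable_sqdot_kernel.
- move=> x Px; rewrite lee_fin [leRHS]ger0_norm; first exact: sqdot_kernel_le.
  by rewrite mulr_ge0 ?sqrtr_ge0.
- have : m.-integrable P (fun x => (kernel_norm x)%:E).
    apply/integrableP; split.
      by apply/measurable_EFinP; exact: measurable_kernel_norm.
    by under eq_integral do rewrite gee0_abs ?lee_fin ?sqrtr_ge0//.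
  by move/(integrableZr mP (Num.sqrt (sqdot h h))).
Qed.

(** By the Cauchy-Schwarz inequality the iterated integral of [|F x t| |h t|] is at
    most [|h|] times the integral of the norms of the [F x], so Fubini's theorem
    applies to [F x t * h t]. *)
Lemma fubini_sqdot_kernel h : sqint h ->
  leb.-integrable P (fun t => (\int[m]_(x in P) F x t * h t)%:E) /\
  \int[leb]_(t in P) (\int[m]_(x in P) F x t * h t) =
    \int[m]_(x in P) sqdot (F x) h.
Proof.
move=> sh; have [mh _] := sh.
pose qs (p : rT * rT) := q h (p.2, p.1).
have mqs : measurable_fun setT (EFin \o qs).
  by apply/measurable_EFinP; apply: (measurableT_comp (mq mh)); exact: measurable_swap.
have sa k : sqint k -> sqint (fun t => `|k t|).
  move=> [mk k2]; split; first exact: measurableT_comp.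
  by under eq_integral do rewrite real_normK ?num_real//.
have da k : sqdot (fun t => `|k t|) (fun t => `|k t|) = sqdot k k.
  by apply: eq_Rintegral => t _; rewrite -normrM ger0_norm// -expr2 sqr_ge0.
have iq : (leb \x m)%E.-integrable setT (EFin \o qs).
  apply/integrable21ltyP => //.
  apply: (@le_lt_trans _ _ (\int[m]_(x in P)
    (kernel_norm x * Num.sqrt (sqdot h h))%:E)%E); last first.
    rewrite (_ : (fun x => _) = fun x =>
      (kernel_norm x)%:E * (Num.sqrt (sqdot h h))%:E)%E//.
    rewrite ge0_integralZr//.
    - by rewrite muleC lte_mul_pinfty// lee_fin sqrtr_ge0.
    - by apply/measurable_EFinP; exact: measurable_kernel_norm.
    - by move=> x _; rewrite lee_fin sqrtr_ge0.
  rewrite [leRHS]integral_mkcond; apply: ge0_le_integral_nonmeasurable.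
    by move=> x _; exact: integral_ge0.
  move=> x _; rewrite patchE; case: ifPn => [/set_mem Px|nPx]; last first.
    have nP : ~ P x by move/mem_set; apply/negP.
    rewrite integral0_eq// => t _.
    by rewrite /= -[qs (t, x)]/((fun t => q h (x, t)) t) (qE0 h nP) normr0.
  have sx := sF Px.
  rewrite (_ : (\int[leb]_t `|(EFin \o qs) (t, x)| =
      (sqdot (fun t => `|F x t|%R) (fun t => `|h t|%R))%:E)%E); last first.
    rewrite /sqdot /Rintegral fineK; last first.
      by apply: integrable_fin_num => //; apply: sqint_mul_integrable => //; exact: sa.
    rewrite [RHS]integral_mkcond; apply: eq_integral => t _.
    rewrite /= -[qs (t, x)]/((fun t => q h (x, t)) t) (qE h Px) /patch.
    by case: ifPn => _; rewrite ?normrM ?normr0.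
  rewrite lee_fin -(da h) /kernel_norm -(da (F x)); apply: le_trans (ler_norm _) _.
  by apply: (sqdot_cauchy_schwarz mP); exact: sa.
have GE t : P t -> (\int[m]_x (qs (t, x))%:E = (\int[m]_(x in P) F x t * h t)%:E)%E.
  move=> Pt; rewrite -RintegralZr//; last exact: im.
  rewrite /Rintegral fineK; last first.
    apply: integrable_fin_num => //.
    exact: (integrableZr mP (h t) (im Pt)).
  rewrite [RHS]integral_mkcond; apply: eq_integral => x _.
  rewrite /qs /q /patch /=; have [Px|nPx] := boolP (x \in P).
    by rewrite mem_set// ?(mem_set Pt)//; split => //; exact: set_mem.
  by rewrite ifF ?mul0r//; apply/negP => /set_mem[/mem_set]; rewrite (negbTE nPx).
have GE0 t : ~ P t -> (\int[m]_x (qs (t, x))%:E = 0)%E.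
  move=> Pt; rewrite integral0_eq// => x _; rewrite /qs /q /patch/=.
  by rewrite [X in _ * (if X then _ else _)](memNset Pt) mulr0.
have FE x : (\int[leb]_t (qs (t, x))%:E =
    if x \in P then (sqdot (F x) h)%:E else 0)%E.
  case: ifPn => [/set_mem Px|nPx].
    rewrite /sqdot /Rintegral fineK; last first.
      by apply: integrable_fin_num => //; apply: sqint_mul_integrable => //; exact: sF.
    rewrite [RHS]integral_mkcond; apply: eq_integral => t _.
    rewrite -[qs (t, x)]/((fun t => q h (x, t)) t) (qE h Px).
    by rewrite /patch; case: ifPn.
  have nP : ~ P x by move/mem_set; apply/negP.
  rewrite integral0_eq// => t _.
  by rewrite -[qs (t, x)]/((fun t => q h (x, t)) t) (qE0 h nP).
have GP : fubini_F m (EFin \o qs) =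
    (fun t => (\int[m]_(x in P) F x t * h t)%:E) \_ P.
  apply/funext => t; rewrite /fubini_F patchE; case: ifPn => [/set_mem/GE//|nP].
  by rewrite GE0//; move/mem_set; apply/negP.
have iG := integrable_fubini_F iq.
rewrite GP in iG.
split; first exact/(integrable_mkcond _ mP).
rewrite [LHS]/Rintegral [RHS]/Rintegral integral_mkcond -GP.
rewrite [X in fine X](Fubini iq); congr fine; rewrite [RHS]integral_mkcond.
by apply: eq_integral => x _; rewrite FE patchE.
Qed.
End Measure.
End SquareIntegrableKernel.

(** * Total and dense subspaces, uniqueness of the RKHS *)

(** The functional [<f, .>] on [S] is represented by a limit of vectors of [S],
    and this limit is [f] because their difference is orthogonal to [S]. *)
Lemma dense_of_total (R : realType) (H : hilbertType R) (S : set H) :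
  S 0 -> (forall a u v, S u -> S v -> S (a *: u + v)) ->
  (forall f, (forall u, S u -> inner f u = 0) -> f = 0) -> dense S.
Proof.
move=> S0 SL Stot O [f Of] oO.
have [s [f' [Ss sf fP]]] := @subspace_riesz R H S (inner f) `|f| S0 SL
  (fun a u v _ _ => eq_trans (innerDr _ _ _) (congr1 (+%R^~ _) (innerZr _ _ _)))
  (fun v _ => cauchy_schwarz f v).
have ff' : f = f'.
  apply/eqP; rewrite -subr_eq0; apply/eqP/Stot => u Su.
  by rewrite innerBl fP ?subrr.
rewrite -ff' in sf.
have [N _ NP] : \forall n \near \oo, O (s n).
  by apply: sf; exact: open_nbhs_nbhs.
by exists (s N); split; [exact: NP (leqnn N)|exact: Ss].
Qed.

Lemma total_of_dense (R : realType) (H : hilbertType R) (S : set H) :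
  dense S -> forall f, (forall u, S u -> inner f u = 0) -> f = 0.
Proof.
move=> dS f fS; apply/eqP; rewrite -normr_eq0 -sqrf_eq0 -inner_norm; apply/eqP.
have [_ cf] := is_dual_inner f.
have [//|ff0] := eqVneq (inner f f) 0.
have /cvgrPdist_lt/(_ `|inner f f|) := cf f.
rewrite normr_gt0 => /(_ ff0)/nbhs_ballP[e /= e0 eP].
have [u [fu Su]] := dS (ball f e) (ex_intro _ f (ballxx f e0)) (ball_open f e).
have : `|inner f f - inner f u| < `|inner f f| := eP _ fu.
by rewrite (fS _ Su) subr0 ltxx.
Qed.

Lemma unitary_norm (R : realType) (H1 H2 : hilbertType R) (U : H1 -> H2) u :
  unitary U -> `|U u| = `|u|.
Proof.
move=> [_ _ iU]; have := iU u u; rewrite !inner_norm => /eqP.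
by rewrite eqrXn2// => /eqP.
Qed.

(** The kernel functions of the two spaces have the Gram matrix [K] and are
    total, since a function orthogonal to all of them vanishes on [D]. *)
Lemma rkhs_unitary (R : realType) (X : Type) (D : set X) (K : X -> X -> R)
    (H1 H2 : hilbertType R) (ev1 : H1 -> X -> R) (ev2 : H2 -> X -> R) :
  is_rkhs D K ev1 -> is_rkhs D K ev2 ->
  exists U : H1 -> H2, unitary U /\
    forall f x, D x -> ev2 (U f) x = ev1 f x.
Proof.
move=> [lin1 inj1 rep1] [lin2 inj2 rep2].
pose B u v := exists x, [/\ D x, forall y, D y -> ev1 u y = K y x,
  forall f, ev1 f x = inner f u, forall y, D y -> ev2 v y = K y x &
  forall f, ev2 f x = inner f v].
have BD x : D x -> exists u v, B u v /\
    (forall f, ev1 f x = inner f u) /\ (forall f, ev2 f x = inner f v).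
  move=> Dx; have [u u1 u2] := rep1 _ Dx; have [v v1 v2] := rep2 _ Dx.
  by exists u, v; split => //; exists x.
have ev0 (H : hilbertType R) (ev : H -> X -> R) :
    (forall a f g x, D x -> ev (a *: f + g) x = a * ev f x + ev g x) ->
    forall x, D x -> ev 0 x = 0.
  by move=> l x Dx; have := l 1 0 0 x Dx; rewrite scaler0 addr0; lra.
have [|f h|f h|U [uU BU]] := @isometric_rel_unitary R H1 H2 B.
- move=> u1 u2 v1 v2 [x [Dx k1 _ k2 _]] [y [Dy _ e1 _ e2]].
  by rewrite -e1 -e2 k1// k2.
- apply: inj1 => x Dx; have [u [v [Bu [e1 _]]]] := BD x Dx.
  by rewrite e1 (h _ _ Bu) (ev0 _ ev1).
- apply: inj2 => x Dx; have [u [v [Bu [_ e2]]]] := BD x Dx.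
  by rewrite e2 (h _ _ Bu) (ev0 _ ev2).
exists U; split => // f x Dx; have [u [v [Bu [e1 e2]]]] := BD x Dx.
by rewrite e2 e1 -(BU _ _ Bu); case: uU => _ _ ->.
Qed.

(** * From Bochner integrability to integrable norms *)

Section HalfLine.
Context (R : realType).
Local Notation rT := (measurableTypeR R).
Local Notation leb := (@lebesgue_measure R).
Local Notation P := (@posR R).
Local Notation sqint := (sqint leb P).
Local Notation sqdot := (sqdot leb P).
Let mP : measurable P := @measurable_posR R.
Hint Resolve mP : core.
Implicit Types f g h : rT -> R.

Lemma L2_cst1 f : L2 (cst 1) f <-> sqint f.
Proof.
rewrite /L2; under eq_integral do rewrite mulr1.
by [].
Qed.

Lemma L2dot_cst1 f g : L2dot (cst 1) f g = sqdot f g.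
Proof. by apply: eq_Rintegral => t _; rewrite mulr1. Qed.

Lemma L2norm_cst1 f : L2norm (cst 1) f = Num.sqrt (sqdot f f).
Proof. by rewrite /L2norm L2dot_cst1. Qed.

Lemma eq_sqint f g : (forall t, P t -> f t = g t) -> sqint f -> sqint g.
Proof.
move=> fg sf; have [mf _] := sf; apply: (sqint_ae mP sf).
  by apply: eq_measurable_fun mf => t /set_mem Pt; exact: fg.
by apply: aeW => t Pt; exact: fg.
Qed.

Lemma eq_L2class f g : (forall t, P t -> f t = g t) -> sqint f ->
  L2class leb mP f = L2class leb mP g.
Proof.
move=> fg sf; apply/L2classP => //; first exact: eq_sqint fg sf.
by apply: aeW => t Pt; exact: fg.
Qed.

(** One approximating simple function already bounds the integral of the norms:
    it has finitely many values and the measure is finite. *)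
Lemma bochner_integrable_norm (m : {measure set rT -> \bar R})
    (F : rT -> rT -> R) :
  (m P < +oo)%E -> measurable_fun P (kernel_norm F) ->
  (forall x, P x -> sqint (F x)) -> bochner_integrable m F ->
  (\int[m]_(x in P) (kernel_norm F x)%:E < +oo)%E.
Proof.
move=> mPoo mN sF [s [simple _ cvg0]].
have [n ltn] : exists n,
    (\int[m]_(x in P) (L2norm (cst 1) (fun t => F x t - s n x t))%:E < +oo)%E.
  have [N _ NP] := cvg_is_fine cvg0.
  by exists N; rewrite ltey_eq; apply/orP; left; exact: NP (leqnn N).
have [fin _ sL2] := simple n.
have [B [B0 BP]] : exists B : R, 0 <= B /\ forall x, L2norm (cst 1) (s n x) <= B.
  have /finite_seqP[l lE] := fin.
  exists (\sum_(g <- l) L2norm (cst 1) g); split.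
    by apply: sumr_ge0 => g _; exact: sqrtr_ge0.
  move=> x; have xl : s n x \in l by have : range (s n) (s n x) by []; rewrite lE.
  rewrite (big_rem _ xl)/= lerDl; apply: sumr_ge0 => g _; exact: sqrtr_ge0.
(* [g x] is at most the norm of [F x - s n x], so its integral is finite *)
pose g x := Num.max (kernel_norm F x - B) 0.
have mg : measurable_fun P g.
  by apply: measurable_maxr => //; apply: measurable_funB.
have g0 x : (0 <= (g x)%:E)%E by rewrite lee_fin le_max lexx orbT.
apply: (@le_lt_trans _ _ (\int[m]_(x in P) ((g x)%:E + B%:E))%E).
  apply: ge0_le_integral_nonmeasurable => x Px; first by rewrite lee_fin sqrtr_ge0.
  rewrite -EFinD lee_fin -lerBlDr /g le_max lexx//.
rewrite ge0_integralD//; last by apply/measurable_EFinP.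
rewrite integral_cst// lte_add_pinfty//; last by rewrite lte_mul_pinfty.
apply: le_lt_trans ltn; apply: ge0_le_integral_nonmeasurable => // x Px.
rewrite lee_fin /g ge_max; apply/andP; split; last exact: sqrtr_ge0.
rewrite lerBlDr; apply: le_trans (lerD (lexx _) (BP x)).
rewrite !L2norm_cst1 /kernel_norm.
have sx := sF _ Px; have ss := (L2_cst1 _).1 (sL2 x).
have sd : sqint (fun t => F x t - s n x t) by exact: sqint_diff.
rewrite -!(L2norm_class mP)//.
have -> : L2class leb mP (F x) = 1 *: L2class leb mP (fun t => F x t - s n x t) +
    L2class leb mP (s n x).
  by rewrite -L2class_lin//; apply: eq_L2class => // t _; rewrite mul1r subrK.
by rewrite scale1r; exact: ler_normD.
Qed.
End HalfLine.

(** * The reproducing kernel Hilbert space of the transform *)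

(** A nonzero value would persist on an interval, which is not negligible. *)
Lemma continuous_ae0 (R : realType) (f : R -> R) :
  {within (@posR R : set R), continuous f} ->
  {ae @lebesgue_measure R, forall t, posR t -> f t = 0} ->
  forall t, 0 < t -> f t = 0.
Proof.
move=> cf [N [mN N0 fN]] t t0.
have opos : open (@posR R : set R).
  rewrite (_ : (@posR R : set R) = `]0, +oo[%classic); first exact: rray_open.
  by apply/seteqP; split => x /=; rewrite in_itv/= andbT.
have ct : {for t, continuous f}.
  by move: cf; rewrite continuous_open_subspace// => /(_ t); apply; rewrite inE.
have [//|ft0] := eqVneq (f t) 0.
have /nbhs_ballP[e /= e0 eP] : \forall x \near t, 0 < x /\ f x != 0.
  apply: filterI; first exact: (open_nbhs_nbhs (conj opos t0)).
  exact: (cvgr_neq0 _ ct ft0).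
pose I : set (measurableTypeR R) := `]t - e, t + e[%classic.
have sub : I `<=` N.
  move=> x; rewrite /I /= in_itv/= => xe; apply: fN => /= h.
  have [x0 fx] : 0 < x /\ f x != 0.
    apply: eP; rewrite -ball_normE /ball_/= ltr_distlC; move: xe => /andP[]; lra.
  by move: fx; rewrite h// eqxx.
have : (@lebesgue_measure R I <= @lebesgue_measure R N)%E.
  by apply: le_measure => //; rewrite inE//; exact: measurable_itv.
rewrite N0 /I lebesgue_measure_itv/= lte_fin ifT; last by lra.
by rewrite -EFinB lee_fin; lra.
Qed.

Lemma measurable_invr (R : realType) : measurable_fun [set: R] (@GRing.inv R).
Proof.
rewrite -(setUv [set 0 : R]); apply/measurable_funU.
- exact: measurable_set1.
- by apply: measurableC; exact: measurable_set1.
split; first exact: measurable_fun_set1.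
apply: open_continuous_measurable_fun.
  rewrite (_ : ~` _ = [set x : R | x != 0]); first exact: open_neq.
  by apply/seteqP; split => x /eqP.
by move=> x /set_mem/eqP x0; exact: inv_continuous.
Qed.

Section Setting.
Context (R : realType).
Local Notation rT := (measurableTypeR R).
Local Notation leb := (@lebesgue_measure R).
Local Notation P := (@posR R).
Local Notation sqint := (sqint leb P).
Local Notation sqdot := (sqdot leb P).
Let mP : measurable P := @measurable_posR R.
Hint Resolve mP : core.
Local Notation X := (L2space leb mP).
Local Notation cls := (L2class leb mP).
Local Notation rep := (@L2repr _ _ _ leb P mP).
Implicit Types f g h : rT -> R.

Context (M : set (signed_measure R)) (T : rT -> rT -> R) (w : rT -> R).
Context (hM : dirac_linear_space M).
Context (hT : measurable_fun (P `*` P) (fun p => T p.1 p.2)).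
Context (hTdef : forall mu, M mu -> forall t, posR t ->
       charge_integrable mu P (T t)).
Context (hTcont : forall mu, M mu ->
       {within (P : set R), continuous (transform T mu : R -> R)}).
Context (hTinj : forall mu nu, M mu -> M nu ->
       (forall t, posR t -> transform T mu t = transform T nu t) ->
       forall A, measurable A -> mu A = nu A).
Context (hw : measurable_fun P w).
Context (hwpos : {ae leb, forall t, posR t -> 0 < w t}).
Context (hPhi : forall x, posR x -> L2 (cst 1) (Phi T w x)).
Context (hSinj : forall h k, L2 (winv w) h -> L2 (winv w) k ->
       (forall x, posR x -> synthesis T h x = synthesis T k x) ->
       ae_eq_pos h k).

Local Notation F := (Phi T w).

Lemma measurable_sqrtw : measurable_fun P (fun t => Num.sqrt (w t)).
Proof.
have ms : measurable_fun setT (Num.sqrt : R -> R).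
  by apply: continuous_measurable_fun; exact: sqrt_continuous.
exact: (measurableT_comp ms hw).
Qed.

Lemma measurable_PP : measurable (P `*` P : set (rT * rT)).
Proof. by apply: measurableX; exact: mP. Qed.

Lemma measurable_Phi : measurable_fun (P `*` P) (fun p : rT * rT => F p.1 p.2).
Proof.
apply: measurable_funM.
  apply: (measurable_comp (F := P) (f := fun t => Num.sqrt (w t)) (g := snd)) => //.
  - by move=> _ [[x t] [_ Pt] <-].
  - exact: measurable_sqrtw.
  - exact: measurable_funTS measurable_snd.
apply: (measurable_comp (F := P `*` P) (f := fun p => T p.1 p.2)
  (g := fun p => (p.2, p.1))) => //.
- exact: measurable_PP.
- by move=> _ [[x t] [Px Pt] <-].
- apply: measurable_funTS; apply: measurable_fun_pair;
  [exact: measurable_snd|exact: measurable_fst].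
Qed.

Lemma sqint_Phi x : P x -> sqint (F x).
Proof. by move=> Px; apply/L2_cst1; exact: hPhi. Qed.

Lemma measurable_Tx x : P x -> measurable_fun P (T ^~ x).
Proof.
move=> Px.
apply: (measurable_comp (F := P `*` P) (f := fun p => T p.1 p.2)
  (g := fun t => (t, x))) => //.
- exact: measurable_PP.
- by move=> _ [t Pt <-].
- apply: measurable_funTS; exact: pair2_measurable.
Qed.

Lemma kernel_wE x y : kernel_w T w x y = sqdot (F x) (F y).
Proof. exact: L2dot_cst1. Qed.

Lemma kernel_w_integral x y : P x -> P y ->
  kernel_w T w x y = \int[leb]_(t in P) (T t x * T t y * w t).
Proof.
move=> Px Py; rewrite kernel_wE; congr fine; apply: ae_eq_integral => //.
- apply/measurable_EFinP.
  by apply: measurable_funM; [case: (sqint_Phi Px)|case: (sqint_Phi Py)].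
- apply/measurable_EFinP; apply: measurable_funM => //.
  by apply: measurable_funM; exact: measurable_Tx.
- apply: filterS hwpos => t h Pt; have wt := h Pt; congr EFin.
  rewrite /Phi mulrACA -expr2 sqr_sqrtr ?ltW//; ring.
Qed.

(** Multiplication by [sqrt w] is a unitary map from L^2 to L^2(1/w) under which
    the synthesis transform becomes the pairing with [Phi]. *)
Definition weighted g t := Num.sqrt (w t) * g t.

Lemma weighted_winv g :
  ae_eq leb P (fun t => weighted g t ^+ 2 * winv w t) (fun t => g t ^+ 2).
Proof.
apply: filterS hwpos => t h Pt; have wt := h Pt.
by rewrite /weighted /winv exprMn sqr_sqrtr ?ltW//; field; rewrite gt_eqF.
Qed.

Lemma measurable_winv : measurable_fun P (winv w).
Proof. exact: (measurableT_comp (@measurable_invr R) hw). Qed.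

Lemma measurable_weighted g : measurable_fun P g -> measurable_fun P (weighted g).
Proof. by move=> mg; apply: measurable_funM => //; exact: measurable_sqrtw. Qed.

Lemma L2_weighted g : sqint g -> L2 (winv w) (weighted g).
Proof.
move=> [mg g2]; split; first exact: measurable_weighted.
apply: le_lt_trans g2; rewrite le_eqVlt; apply/orP; left; apply/eqP.
apply: ae_eq_integral => //.
- apply/measurable_EFinP; apply: measurable_funM; last exact: measurable_winv.
  by apply: measurable_funX; exact: measurable_weighted.
- exact: measurable_EFin_sqr.
- by have := weighted_winv g; apply: filterS => t h Pt; rewrite h.
Qed.

Lemma L2dot_weighted f g : sqint f -> sqint g ->
  L2dot (winv w) (weighted f) (weighted g) = sqdot f g.
Proof.
move=> [mf _] [mg _]; congr fine; apply: ae_eq_integral => //.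
- apply/measurable_EFinP; apply: measurable_funM; last exact: measurable_winv.
  by apply: measurable_funM; exact: measurable_weighted.
- by apply/measurable_EFinP; exact: measurable_funM.
- apply: filterS hwpos => t h Pt; have wt := h Pt; congr EFin.
  rewrite /weighted /winv mulrACA -expr2 sqr_sqrtr ?ltW//; field.
  by rewrite gt_eqF.
Qed.

Lemma ae_eq_L2dot f f' g g' :
  L2 (winv w) f -> L2 (winv w) f' -> L2 (winv w) g -> L2 (winv w) g' ->
  ae_eq_pos f f' -> ae_eq_pos g g' ->
  L2dot (winv w) f g = L2dot (winv w) f' g'.
Proof.
move=> [mf _] [mf' _] [mg _] [mg' _] ff' gg'; congr fine; apply: ae_eq_integral => //.
- apply/measurable_EFinP; apply: measurable_funM; last exact: measurable_winv.
  exact: measurable_funM.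
- apply/measurable_EFinP; apply: measurable_funM; last exact: measurable_winv.
  exact: measurable_funM.
- by apply: filterS2 ff' gg' => t h k Pt; rewrite h// k.
Qed.

Lemma synthesis_weighted g x : synthesis T (weighted g) x = sqdot (F x) g.
Proof. by apply: eq_Rintegral => t _; rewrite /weighted /Phi; ring. Qed.

Lemma ae_eq_weighted f g : ae_eq_pos (weighted f) (weighted g) -> ae_eq leb P f g.
Proof.
move=> fg; apply: filterS2 hwpos fg => t wt h Pt.
have s0 : Num.sqrt (w t) != 0 by rewrite gt_eqF// sqrtr_gt0 wt.
by apply: (mulfI s0); exact: h.
Qed.

(** The function on [(0, oo)] represented by [u]; it is the synthesis of
    [sqrt w u]. *)
Definition L2ev (u : X) (x : rT) : R := sqdot (F x) (rep u).

Lemma L2evE u x : P x -> L2ev u x = inner u (cls (F x)).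
Proof.
move=> Px; rewrite /L2ev innerC -[u in RHS]L2reprK.
by rewrite /inner/= L2innerE//; [exact: sqint_Phi|exact: sqint_repr].
Qed.

(** This is the injectivity of the synthesis transform on [L^2(1/w)]. *)
Lemma L2ev_inj u v : (forall x, P x -> L2ev u x = L2ev v x) -> u = v.
Proof.
move=> uv; have su := sqint_repr u; have sv := sqint_repr v.
rewrite -(L2reprK u) -(L2reprK v); apply/L2classP => //.
apply: ae_eq_weighted; apply: hSinj; [exact: L2_weighted|exact: L2_weighted|].
by move=> x Px; rewrite !synthesis_weighted; exact: uv.
Qed.

Lemma Phi_total u : (forall x, P x -> inner u (cls (F x)) = 0) -> u = 0.
Proof.
by move=> h; apply: L2ev_inj => x Px; rewrite !L2evE// h// inner0l.
Qed.

Lemma inner_Phi x y : P x -> P y ->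
  inner (cls (F x)) (cls (F y)) = kernel_w T w x y.
Proof.
by move=> Px Py; rewrite kernel_wE /inner/= L2innerE//; exact: sqint_Phi.
Qed.

Lemma is_rkhs_L2ev : is_rkhs P (kernel_w T w) L2ev.
Proof.
split=> [a f g x Px|f g|x Px]; last first.
- exists (cls (F x)) => [y Py|f]; last exact: L2evE.
  by rewrite L2evE// inner_Phi// !kernel_wE sqdotC.
- exact: L2ev_inj.
- by rewrite !L2evE// innerDl innerZl.
Qed.

Lemma determines_rkhs_kernel_w : determines_rkhs P (kernel_w T w).
Proof.
exists X, L2ev; split; first exact: is_rkhs_L2ev.
move=> H' ev' rk'; have [U [[bU _ iU] eU]] := rkhs_unitary is_rkhs_L2ev rk'.
by exists U.
Qed.

Section RKHS.
Context (Hw : hilbertType R) (ev : Hw -> rT -> R).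
Context (rk : is_rkhs P (kernel_w T w) ev).

(** [synthesis_inv] is a choice of preimage, which injectivity of [S] determines
    up to almost everywhere equality. *)
Lemma synthesis_inv_weighted (V : X -> Hw) u :
  (forall u x, P x -> ev (V u) x = L2ev u x) ->
  [/\ synthesis_at T w (ev (V u)) (weighted (rep u)),
      L2 (winv w) (synthesis_inv T w (ev (V u))) &
      ae_eq_pos (synthesis_inv T w (ev (V u))) (weighted (rep u))].
Proof.
move=> eV; have at0 : synthesis_at T w (ev (V u)) (weighted (rep u)).
  split; first by apply: L2_weighted; exact: sqint_repr.
  by move=> x Px; rewrite synthesis_weighted eV.
have [L2i Si] : synthesis_at T w (ev (V u)) (synthesis_inv T w (ev (V u))).
  by apply: xgetPex; exists (weighted (rep u)).
split => //; apply: hSinj => //; first by case: at0.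
by move=> x Px; rewrite Si// (proj2 at0).
Qed.

Lemma inner_synthesis_inv (f g : Hw) : [/\ exists h, synthesis_at T w (ev f) h,
               exists k, synthesis_at T w (ev g) k &
               inner f g =
               L2dot (winv w) (synthesis_inv T w (ev f))
                 (synthesis_inv T w (ev g))].
Proof.
have [V [[[V' _ VV'] _ iV] eV]] := rkhs_unitary is_rkhs_L2ev rk.
rewrite -(VV' f) -(VV' g).
have [f1 f2 f3] := synthesis_inv_weighted (V' f) eV.
have [g1 g2 g3] := synthesis_inv_weighted (V' g) eV.
split; [by exists (weighted (rep (V' f)))|by exists (weighted (rep (V' g)))|].
rewrite (ae_eq_L2dot f2 (proj1 f1) g2 (proj1 g1) f3 g3) iV.
by rewrite L2dot_weighted//; exact: sqint_repr.
Qed.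
End RKHS.

(** * Finitely supported measures *)

(** The combination of Dirac masses with the coefficients and points listed in
    [l]; the trailing null multiple makes the empty combination an element
    of [M] as well. *)
Definition dirac_comb (l : seq (R * R)) : signed_measure R :=
  foldr (fun p mu => cadd (cscale p.1 (dirac_charge p.2)) mu)
    (cscale 0 (dirac_charge 1)) l.

Definition pos_points (l : seq (R * R)) := forall p, p \in l -> P p.2.

Lemma pos_points_cons p l : pos_points (p :: l) <-> P p.2 /\ pos_points l.
Proof.
split=> [h|[h1 h2] q]; last by rewrite inE => /predU1P[->|/h2].
by split=> [|q ql]; apply: h; rewrite inE ?eqxx// ql orbT.
Qed.

Let MD mu nu : M mu -> M nu -> M (cadd mu nu).
Proof. by case: hM => _ + _ _; exact. Qed.
Let MZ a mu : M mu -> M (cscale a mu).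
Proof. by case: hM => _ _ + _; exact. Qed.
Let Mdirac a : P a -> M (dirac_charge a).
Proof. by case: hM => _ _ _; exact. Qed.

Lemma M_dirac_comb l : pos_points l -> M (dirac_comb l).
Proof.
elim: l => [_|p l ih /pos_points_cons[pp pl]] /=.
  by apply/MZ/Mdirac; rewrite /posR /= ltr01.
by apply: MD; [apply/MZ/Mdirac|exact: ih].
Qed.

Lemma transform_cadd mu nu t : M mu -> M nu -> P t ->
  transform T (cadd mu nu) t = transform T mu t + transform T nu t.
Proof.
move=> Mmu Mnu Pt; apply: charge_integral_cadd => //; apply: hTdef => //.
exact: MD.
Qed.

Lemma transform_cscale a mu t : M mu -> P t ->
  transform T (cscale a mu) t = a * transform T mu t.
Proof.
move=> Mmu Pt; apply: charge_integral_cscale => //; apply: hTdef => //.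
exact: MZ.
Qed.

Lemma transform_dirac a t : P a -> P t -> transform T (dirac_charge a) t = T t a.
Proof.
by move=> Pa Pt; apply: charge_integral_dirac => //; apply: hTdef => //; exact: Mdirac.
Qed.

Lemma transform_dirac_comb l t : pos_points l -> P t ->
  transform T (dirac_comb l) t = \sum_(p <- l) p.1 * T t p.2.
Proof.
move=> + Pt; elim: l => [_|p l ih /pos_points_cons[pp pl]].
  by rewrite big_nil transform_cscale ?mul0r//; apply: Mdirac; rewrite /posR/= ltr01.
rewrite big_cons/= transform_cadd//; first last.
- exact: M_dirac_comb.
- by apply/MZ/Mdirac.
by rewrite transform_cscale ?transform_dirac ?ih//; exact: Mdirac.
Qed.

Lemma dirac_combE l A : dirac_comb l A = (\sum_(p <- l) p.1 * \1_A p.2)%:E.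
Proof.
elim: l => [|p l ih]; first by rewrite big_nil /= /cscale/= mul0e.
by rewrite big_cons EFinD EFinM -ih.
Qed.

Lemma weighted_sum l t :
  weighted (fun t => \sum_(p <- l) p.1 * T t p.2) t = \sum_(p <- l) p.1 * F p.2 t.
Proof.
by rewrite /weighted mulr_sumr; apply: eq_bigr => p _; rewrite /Phi; ring.
Qed.

Lemma sqint_Phi_sum l : pos_points l ->
  sqint (fun t => \sum_(p <- l) p.1 * F p.2 t) /\
  cls (fun t => \sum_(p <- l) p.1 * F p.2 t) = \sum_(p <- l) p.1 *: cls (F p.2).
Proof.
elim: l => [_|p l ih /pos_points_cons[pp pl]].
  split; last first.
    rewrite big_nil; apply/esym; transitivity (cls (fun=> 0)) => //.
    by congr L2class; apply/funext => t; rewrite big_nil.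
  by apply: (eq_sqint (f := fun=> 0)) (sqint0 _ _) => t _; rewrite big_nil.
have [sl cl] := ih pl; have sp := sqint_Phi pp.
have e t : p.1 * F p.2 t + \sum_(q <- l) q.1 * F q.2 t =
  \sum_(q <- p :: l) q.1 * F q.2 t by rewrite big_cons.
have sc := sqint_lin mP p.1 sp sl.
split; first exact: eq_sqint (fun t _ => e t) sc.
by rewrite -(eq_L2class (fun t _ => e t) sc) L2class_lin// cl big_cons.
Qed.

Lemma finite_measurable (S : set rT) : finite_set S -> measurable S.
Proof.
move=> fS; apply: countable_measurable; first exact: measurable_set1.
exact: finite_set_countable.
Qed.

(** If the vectors [Phi x_i] were dependent, the continuous transform of the
    corresponding combination of Dirac masses would vanish almost everywhere,
    hence everywhere, contradicting the injectivity of [T]. *)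
Lemma strictly_positive_definite_kernel_w : strictly_positive_definite P (kernel_w T w).
Proof.
move=> n x c injx Px [i0 ci0].
pose l := [seq (c i, x i) | i <- enum 'I_n].
have pl : pos_points l by move=> p /mapP[i _ ->]; exact: Px.
have [sl cl] := sqint_Phi_sum pl.
pose u : X := \sum_(p <- l) p.1 *: cls (F p.2).
have uE : u = \sum_(i < n) c i *: cls (F (x i)) by rewrite /u big_map big_enum.
have -> : \sum_(i < n) \sum_(j < n) c i * c j * kernel_w T w (x i) (x j) = inner u u.
  have suml (v : X) : inner u v = \sum_(i < n) c i * inner (cls (F (x i))) v.
    rewrite uE; elim/big_rec2: _ => [|i a b _ ih]; first exact: inner0l.
    by rewrite innerDl innerZl ih.
  rewrite suml; apply: eq_bigr => i _; rewrite innerC suml mulr_sumr.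
  by apply: eq_bigr => j _; rewrite innerC inner_Phi// mulrA.
rewrite inner_norm exprn_gt0// normr_gt0; apply/eqP => u0.
have Tl0 : forall t, P t -> transform T (dirac_comb l) t = 0.
  apply: continuous_ae0; first by apply: hTcont; exact: M_dirac_comb.
  have : ae_eq leb P (weighted (fun t => \sum_(p <- l) p.1 * T t p.2)) (weighted (fun=> 0)).
    have e t : weighted (fun t => \sum_(p <- l) p.1 * T t p.2) t =
       \sum_(p <- l) p.1 * F p.2 t by exact: weighted_sum.
    apply: (ae_eq_trans (g := fun t => \sum_(p <- l) p.1 * F p.2 t)).
      by apply: aeW => t _; exact: e.
    apply: (ae_eq_trans (g := fun=> 0)); last first.
      by apply: aeW => t _; rewrite /weighted mulr0.
    by apply/L2classP => //; [exact: sqint0|rewrite cl -/u u0].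
  move/ae_eq_weighted; apply: filterS => t h Pt.
  by rewrite transform_dirac_comb//; exact: h.
have M0 : M (dirac_comb [::]) by apply: M_dirac_comb.
have /(_ [set x i0]) : forall A, measurable A -> dirac_comb l A = dirac_comb [::] A.
  apply: hTinj => //; first exact: M_dirac_comb.
  by move=> t Pt; rewrite Tl0// transform_dirac_comb// big_nil.
rewrite !dirac_combE big_nil big_map big_enum/= => /(_ (measurable_set1 _))[].
rewrite (bigD1 i0)//= indicE mem_set// mulr1 big1 ?addr0.
  by move/eqP; rewrite (negbTE ci0).
move=> i ii0; rewrite indicE memNset ?mulr0//= => /injx e.
by rewrite e eqxx in ii0.
Qed.

(** The variation charges only the finite set of points of [l], where [Phi] equals
    the simple function that vanishes outside this set; the constant sequence of
    that function is therefore an approximation. *)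
Lemma Mw0_dirac_comb l : pos_points l -> Mw0 M T w (dirac_comb l).
Proof.
move=> pl; split; first exact: M_dirac_comb.
pose S : set rT := [set` [seq p.2 | p <- l]].
have mS : measurable S.
  by apply: finite_measurable; exact: finite_seq.
have vS : variation (dirac_comb l) (~` S) = 0%E.
  apply: variation_null => // A mA AS; rewrite dirac_combE big_seq big1// => p pl'.
  rewrite indicE memNset ?mulr0// => Ap.
  by rewrite -[False]/(set0 p.2) -AS; split => //; exact: map_f.
pose s y : rT -> R := if y \in S then F y else fun=> 0.
have sE y : ~ (~` S) y -> L2norm (cst 1) (fun t => F y t - s y t) = 0.
  move=> /contrapT Sy; rewrite L2norm_cst1 /s mem_set//.
  rewrite /sqdot (_ : (fun t => _) = fun=> 0); last first.
    by apply/funext => t; rewrite subrr mul0r.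
  by rewrite /Rintegral integral0 sqrtr0.
exists (fun=> s); split.
- move=> n; split.
  + apply: (sub_finite_set (B := (F @` S) `|` [set fun=> 0])).
      move=> _ [y _ <-]; rewrite /s; case: ifPn => [/set_mem Sy|_]; last by right.
      by left; exists y.
    by rewrite finite_setU; split => //; apply: finite_image; exact: finite_seq.
  + move=> g; have -> : s @^-1` [set g] = (S `&` [set y | F y = g]) `|`
       (~` S `&` [set y | (fun=> 0) = g]).
      apply/seteqP; split => y /=; rewrite /s.
        by case: ifPn => [/set_mem Sy ->|/negP Sy ->]; [left|right];
          split => // /mem_set.
      by case=> -[Sy <-]; [rewrite mem_set|rewrite memNset].
    apply: measurableU.
      apply: finite_measurable.
      by apply: sub_finite_set (@subIsetl _ _ _) _; exact: finite_seq.
    have [<-|ne] := pselect ((fun=> 0) = g).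
      rewrite (_ : [set _ | _] = setT) ?setIT; first exact: measurableC.
      by apply/seteqP; split.
    rewrite (_ : [set _ | _] = set0) ?setI0//.
    by apply/seteqP; split.
  + move=> y; rewrite /s; case: ifPn => [/set_mem Sy|_].
      have /mapP[p pl' ->] : y \in [seq p.2 | p <- l] by exact: Sy.
      by apply: hPhi; exact: pl.
    by apply/L2_cst1; exact: sqint0.
- exists (~` S); split => //; first exact: measurableC.
  move=> y /= h Sy; apply: h => _.
  have nSy : ~ (~` S) y by exact.
  by rewrite (sE _ nSy); exact: cvg_cst.
- rewrite (_ : (fun n => _) = fun=> 0%E); first exact: cvg_cst.
  apply/funext => n; apply/eqP; rewrite eq_le; apply/andP; split; last first.
    by apply: integral_ge0 => y _; rewrite lee_fin sqrtr_ge0.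
  apply: (@le_trans _ _ (\int[variation (dirac_comb l)]_(y in P)
     ((cst +oo%E) \_ (~` S)) y)%E).
    apply: ge0_le_integral_nonmeasurable => y Py.
      by rewrite lee_fin sqrtr_ge0.
    rewrite patchE; case: ifPn => [_|/negP nS]; first exact: leey.
    by rewrite sE// => /mem_set.
  rewrite -integral_mkcondr integral_cst; last first.
    by apply: measurableI => //; exact: measurableC.
  rewrite (_ : variation _ _ = 0%E) ?mule0//.
  apply/eqP; rewrite eq_le measure_ge0 andbT -vS.
  by apply: le_measure; rewrite ?inE//; [apply: measurableI => //|]; exact: measurableC.
Qed.

(** * The analysis map and the completion of the space of measures *)

Definition analysis (mu : signed_measure R) : rT -> R := weighted (transform T mu).

Section Measure.
Context (mu : signed_measure R) (Mw : Mw0 M T w mu).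
Local Notation jp := (jordan_pos (hahnP mu)).
Local Notation jn := (jordan_neg (hahnP mu)).

Let Mmu : M mu. Proof. by case: Mw. Qed.

Lemma variation_kernel_norm_lty :
  (\int[variation mu]_(x in P) (kernel_norm F x)%:E < +oo)%E.
Proof.
apply: bochner_integrable_norm.
- by rewrite variationE lte_add_pinfty// ltey_eq fin_num_measure.
- exact: measurable_kernel_norm measurable_Phi.
- exact: sqint_Phi.
- by case: Mw.
Qed.

Let N0 x : P x -> (0 <= (kernel_norm F x)%:E)%E.
Proof. by rewrite lee_fin sqrtr_ge0. Qed.

Let mN : measurable_fun P (fun x => (kernel_norm F x)%:E).
Proof. by apply/measurable_EFinP; exact: measurable_kernel_norm measurable_Phi. Qed.

Let Np : (\int[jp]_(x in P) (kernel_norm F x)%:E < +oo)%E.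
Proof.
apply: le_lt_trans variation_kernel_norm_lty.
by rewrite (ge0_integral_variation mP _ N0 mN) leeDl// integral_ge0.
Qed.

Let Nn : (\int[jn]_(x in P) (kernel_norm F x)%:E < +oo)%E.
Proof.
apply: le_lt_trans variation_kernel_norm_lty.
by rewrite (ge0_integral_variation mP _ N0 mN) leeDr// integral_ge0.
Qed.

Let iT t : P t -> jp.-integrable P (EFin \o T t) /\ jn.-integrable P (EFin \o T t).
Proof. by move=> Pt; apply/(charge_integrableP mP); exact: hTdef. Qed.

Let iFp t : P t -> jp.-integrable P (fun x => (F x t)%:E).
Proof. by move=> /iT[i _]; exact: (integrableZl mP (Num.sqrt (w t)) i). Qed.

Let iFn t : P t -> jn.-integrable P (fun x => (F x t)%:E).
Proof. by move=> /iT[_ i]; exact: (integrableZl mP (Num.sqrt (w t)) i). Qed.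

Lemma analysisE t : P t ->
  analysis mu t = \int[jp]_(x in P) F x t - \int[jn]_(x in P) F x t.
Proof.
move=> Pt; have [ip ine] := iT Pt.
rewrite /analysis /weighted /transform /charge_integral mulrBr.
by rewrite -!RintegralZl.
Qed.

Lemma charge_integrable_pairing h : sqint h ->
  charge_integrable mu P (fun x => sqdot (F x) h).
Proof.
move=> sh; apply/(charge_integrableP mP); split.
  exact: (integrable_sqdot_kernel measurable_Phi sqint_Phi Np).
exact: (integrable_sqdot_kernel measurable_Phi sqint_Phi Nn).
Qed.

Lemma analysis_pairing h : sqint h ->
  sqdot (analysis mu) h = charge_integral mu P (fun x => sqdot (F x) h).
Proof.
move=> sh.
have [ip ep] := fubini_sqdot_kernel measurable_Phi sqint_Phi Np iFp sh.
have [ine en] := fubini_sqdot_kernel measurable_Phi sqint_Phi Nn iFn sh.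
rewrite /charge_integral -ep -en -RintegralB//.
by apply: eq_Rintegral => t /set_mem Pt; rewrite analysisE// mulrBl.
Qed.

(** The pairing with [h] is at most [C |h|], where [C] is the integral of
    the norms of the [Phi x] against the variation of [mu]. *)
Lemma sqint_analysis : sqint (analysis mu).
Proof.
pose C := fine (\int[variation mu]_(x in P) (kernel_norm F x)%:E)%E.
have mA : measurable_fun P (analysis mu).
  apply: measurable_weighted; apply: subspace_continuous_measurable_fun => //.
  exact: hTcont.
apply: (@sqint_of_bounded_pairing _ _ C mA) => h sh.
rewrite analysis_pairing// -lee_fin.
have ih := charge_integrable_pairing sh.
apply: le_trans (norm_charge_integral_le mP ih) _.
rewrite EFinM fineK; last first.
  by rewrite ge0_fin_numE ?variation_kernel_norm_lty// integral_ge0.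
rewrite -(ge0_integralZr _ mP mN N0); last by rewrite lee_fin sqrtr_ge0.
apply: ge0_le_integral_nonmeasurable => x Px; first by rewrite lee_fin.
by rewrite -EFinM lee_fin; exact: (sqdot_kernel_le sqint_Phi).
Qed.

End Measure.

Lemma dot_wE mu nu : Mw0 M T w mu -> Mw0 M T w nu ->
  dot_w T w mu nu = sqdot (analysis mu) (analysis nu).
Proof.
move=> Mmu Mnu; have [mA _] := sqint_analysis Mmu; have [mB _] := sqint_analysis Mnu.
have mt k : Mw0 M T w k -> measurable_fun P (transform T k).
  move=> [Mk _]; apply: subspace_continuous_measurable_fun => //; exact: hTcont.
congr fine; apply: ae_eq_integral => //.
- apply/measurable_EFinP; apply: measurable_funM => //.
  by apply: measurable_funM; exact: mt.
- by apply/measurable_EFinP; exact: measurable_funM.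
- apply: filterS hwpos => t h Pt; have wt := h Pt; congr EFin.
  by rewrite /analysis /weighted mulrACA -expr2 sqr_sqrtr ?ltW//; ring.
Qed.

Definition L2embed (mu : signed_measure R) : X := cls (analysis mu).

Lemma L2embed_dirac_comb l : pos_points l ->
  L2embed (dirac_comb l) = \sum_(p <- l) p.1 *: cls (F p.2).
Proof.
move=> pl; have [sl <-] := sqint_Phi_sum pl.
apply/esym; apply: eq_L2class => // t Pt.
by rewrite -weighted_sum /analysis /weighted transform_dirac_comb.
Qed.

(** Density holds already for the combinations of Dirac masses, whose images are
    the combinations of the total family [Phi]. *)
Lemma is_completion_L2embed : is_completion M T w L2embed.
Proof.
split.
- move=> mu nu Mmu Mnu; have sm := sqint_analysis Mmu; have sn := sqint_analysis Mnu.
  rewrite -[L2embed mu]scale1r /L2embed -L2class_lin//; apply/esym; apply: eq_L2class.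
    move=> t Pt; rewrite /analysis /weighted transform_cadd//; first by ring.
      by case: Mmu.
    by case: Mnu.
  exact: sqint_lin.
- move=> a mu Mmu; have sm := sqint_analysis Mmu.
  have := L2class_lin mP a sm (sqint0 _ _).
  have -> : cls (fun=> 0) = 0 by [].
  rewrite addr0 => <-; apply/esym; apply: eq_L2class; last first.
    exact: (sqint_lin mP a sm (sqint0 _ _)).
  move=> t Pt; rewrite /analysis /weighted transform_cscale//; first by ring.
  by case: Mmu.
- move=> mu nu Mmu Mnu; rewrite dot_wE// /inner/= L2innerE//; exact: sqint_analysis.
- pose S : set X := [set u | exists2 l, pos_points l &
    u = \sum_(p <- l) p.1 *: cls (F p.2)].
  have dS : dense S.
    apply: dense_of_total.
    + by exists [::] => //; rewrite big_nil.
    + move=> a _ _ [l pl ->] [k pk ->].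
      exists ([seq (a * p.1, p.2) | p <- l] ++ k).
        move=> p; rewrite mem_cat => /orP[/mapP[q ql pq]|]; last exact: pk.
        by rewrite pq; exact: (pl q).
      rewrite big_cat big_map scaler_sumr; congr (_ + _).
      by apply: eq_bigr => p _; rewrite scalerA.
    + move=> f fS; apply: Phi_total => x Px; apply: fS.
      exists [:: (1, x)]; first by move=> p; rewrite inE => /eqP ->.
      by rewrite big_seq1 scale1r.
  move=> O O0 oO; have [v [Ov [l pl vE]]] := dS O O0 oO.
  exists (L2embed (dirac_comb l)); split; first by rewrite L2embed_dirac_comb// -vE.
  by exists (dirac_comb l) => //; exact: Mw0_dirac_comb.
Qed.

Lemma completion_unitary (H : hilbertType R) (iota : signed_measure R -> H) :
  is_completion M T w iota -> exists U : H -> X, unitary U /\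
    forall mu, Mw0 M T w mu -> U (iota mu) = L2embed mu.
Proof.
move=> [_ _ dotH denseH]; have [_ _ dotX denseX] := is_completion_L2embed.
pose B u v := exists mu, [/\ Mw0 M T w mu, iota mu = u & L2embed mu = v].
have [|f h|f h|U [uU BU]] := @isometric_rel_unitary R H X B.
- move=> _ _ _ _ [mu [Mmu <- <-]] [nu [Mnu <- <-]].
  by rewrite dotH// dotX.
- apply: (total_of_dense denseH) => _ [mu Mmu <-].
  by apply: (h _ (L2embed mu)); exists mu.
- apply: (total_of_dense denseX) => _ [mu Mmu <-].
  by apply: (h _ (iota mu)); exists mu.
by exists U; split => // mu Mmu; apply: BU; exists mu.
Qed.

(** With [V] from [L^2] onto [H_w] and [U] from the completion onto [L^2], the
    isometry is [u |-> <V (U u), .>]; it is onto by the Riesz theorem. *)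
Lemma pairing_isometry (Hw : hilbertType R) (ev : Hw -> rT -> R)
    (H : hilbertType R) (iota : signed_measure R -> H) :
  is_rkhs P (kernel_w T w) ev -> is_completion M T w iota ->
  exists J : H -> Hw -> R, isometry_onto_dual J /\
    forall mu (f : Hw), Mw0 M T w mu ->
      charge_integrable mu P (ev f) /\
      J (iota mu) f = charge_integral mu P (ev f).
Proof.
move=> rk cH; have [V [uV eV]] := rkhs_unitary is_rkhs_L2ev rk.
have [U [uU eU]] := completion_unitary cH.
have [[V' _ VV'] linV iV] := uV; have [[U' _ UU'] linU iU] := uU.
exists (fun u => inner (V (U u))); split.
  split.
  - by move=> u; exact: is_dual_inner.
  - by move=> a u v f; rewrite linU linV innerDl innerZl.
  - move=> phi /riesz[u ->]; exists (U' (V' u)).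
    by rewrite UU' VV'.
  - by move=> u; rewrite dual_norm_inner !unitary_norm.
move=> mu f Mmu; rewrite -(VV' f); set u := V' f.
have su := sqint_repr u.
have eq_ev x : x \in P -> sqdot (F x) (rep u) = ev (V u) x.
  by move=> /set_mem Px; rewrite eV.
have eq_evE x : x \in P -> (EFin \o (fun x => sqdot (F x) (rep u))) x = (EFin \o ev (V u)) x.
  by move=> Px /=; rewrite eq_ev.
split.
  apply: eq_integrable (charge_integrable_pairing Mmu su) => //.
rewrite eU// iV -[u in LHS]L2reprK /L2embed /inner/= L2innerE//; last first.
  exact: sqint_analysis.
rewrite analysis_pairing//; congr (_ - _); exact: eq_Rintegral.
Qed.

End Setting.

Theorem proposition3p1 (R : realType)
    (M : set (signed_measure R))
    (T : measurableTypeR R -> measurableTypeR R -> R)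
    (w : measurableTypeR R -> R)
    (hM : dirac_linear_space M)
    (hT : measurable_fun (@posR R `*` @posR R) (fun p => T p.1 p.2))
    (hTdef : forall mu, M mu -> forall t, posR t ->
       charge_integrable mu (@posR R) (T t))
    (hTcont : forall mu, M mu ->
       {within (@posR R : set R), continuous (transform T mu : R -> R)})
    (hTinj : forall mu nu, M mu -> M nu ->
       (forall t, posR t -> transform T mu t = transform T nu t) ->
       forall A, measurable A -> mu A = nu A)
    (hw : measurable_fun (@posR R) w)
    (hwpos : {ae @lebesgue_measure R, forall t, posR t -> 0 < w t})
    (hPhi : forall x, posR x -> L2 (cst 1) (Phi T w x))
    (hSdef : forall h, L2 (winv w) h -> forall x, posR x ->
       (@lebesgue_measure R).-integrable (@posR R) (fun t => (T t x * h t)%:E))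
    (hSinj : forall h k, L2 (winv w) h -> L2 (winv w) k ->
       (forall x, posR x -> synthesis T h x = synthesis T k x) ->
       ae_eq_pos h k) :
  [/\ (forall x y, posR x -> posR y ->
         kernel_w T w x y =
         \int[@lebesgue_measure R]_(t in @posR R) (T t x * T t y * w t)),
      strictly_positive_definite (@posR R) (kernel_w T w),
      determines_rkhs (@posR R) (kernel_w T w) &
      forall (Hw : hilbertType R) (ev : Hw -> measurableTypeR R -> R),
        is_rkhs (@posR R) (kernel_w T w) ev ->
        (forall f g : Hw,
           [/\ exists h, synthesis_at T w (ev f) h,
               exists k, synthesis_at T w (ev g) k &
               inner f g =
               L2dot (winv w) (synthesis_inv T w (ev f))
                 (synthesis_inv T w (ev g))]) /\
        (exists (Hw' : hilbertType R) (iota : _ -> Hw'),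
           is_completion M T w iota) /\
        (forall (Hw' : hilbertType R) (iota : _ -> Hw'),
           is_completion M T w iota ->
           exists J : Hw' -> Hw -> R,
             isometry_onto_dual J /\
             forall mu f, Mw0 M T w mu ->
               charge_integrable mu (@posR R) (ev f) /\
               J (iota mu) f = charge_integral mu (@posR R) (ev f))].
Proof.
split.
- exact: kernel_w_integral.
- exact: (strictly_positive_definite_kernel_w hM hTdef hTcont hTinj hwpos hPhi).
- exact: (determines_rkhs_kernel_w hw hwpos hPhi hSinj).
move=> Hw ev rk; split; last split.
- by move=> f g; exact: (inner_synthesis_inv hw hwpos hPhi hSinj rk).
- eexists; eexists.
  exact: (is_completion_L2embed hM hT hTdef hTcont hw hwpos hPhi hSinj).
- move=> Hw' iota cH.
  exact: (pairing_isometry hM hT hTdef hTcont hw hwpos hPhi hSinj rk cH).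
Qed.
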